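(* Let $1\le p\le\infty$, let $q$ satisfy $1/p+1/q=1$, let $F\in L^p(\mathbb{T})$, and let $f=\mathcal{P}[F]$ be the harmonic mapping in the unit disk $\mathbb{D}$ induced by $F$. If $f$ is normalized so that $f(0)=f_z(0)-1=f_{\overline{z}}(0)=0$, then $f$ is univalent in the disk $\mathbb{D}_{r_0}$ and $f(\mathbb{D}_{r_0})$ contains a schlicht disk $\mathbb{D}_{R_0}$, where $$r_0=1-\frac{\sqrt{4C_q^2\|F\|_p^2+2C_q\|F\|_p}}{2C_q\|F\|_p+1},\qquad R_0=r_0-\frac{2C_q\|F\|_p\,r_0^2}{1-r_0},$$ and $$C_q=\left(\frac{1}{2\pi}\int_0^{2\pi}|\cos(nt)|^q\,dt\right)^{1/q}.$$
   Context: For $r>0$, $\mathbb{D}_r=\{z\in\mathbb{C}:|z|<r\}$, $\mathbb{D}=\mathbb{D}_1$, $\mathbb{T}=\partial\mathbb{D}$. For $p\in[1,\infty]$, $L^p(\mathbb{T})$ is the set of measurable functions $F:\mathbb{T}\to\mathbb{C}$ with finite norm $$\|F\|_p=\left(\int_0^{2\pi}|F(e^{it})|^p\,dt\right)^{1/p}\ (1\le p<\infty),\qquad \|F\|_\infty=\operatorname{ess\,sup}\{|F(e^{it})|:t\in[0,2\pi]\}.$$ The Poisson integral of $F$ is, for $z=re^{i\theta}\in\mathbb{D}$, $$\mathcal{P}[F](z)=\frac{1}{2\pi}\int_0^{2\pi}\mathcal{P}(re^{i(\theta-t)})F(e^{it})\,dt,\qquad \mathcal{P}(z)=\frac{1-|z|^2}{|1-z|^2}.$$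 The complex derivatives are $f_z=\frac12\left(\frac{\partial f}{\partial x}-i\frac{\partial f}{\partial y}\right)$ and $f_{\overline z}=\frac12\left(\frac{\partial f}{\partial x}+i\frac{\partial f}{\partial y}\right)$, where $z=x+iy$. Univalent means injective. A disk $D$ is a schlicht disk for $f$ if there is a region $\Omega$ (here $\Omega\subset\mathbb{D}_{r_0}$) such that $f$ is univalent on $\Omega$ and $f(\Omega)=D$. In the definition of $C_q$, $n$ is any positive integer (the value does not depend on $n$); for $q=\infty$ (that is, $p=1$) one sets $C_q=1$, and for $q=1$ (that is, $p=\infty$) one has $C_q=2/\pi$. *)

(* Defs.v *)
From mathcomp Require Import all_boot all_order all_algebra.
From mathcomp Require Import all_classical all_reals all_analysis.
From mathcomp Require Import complex.
Set Implicit Arguments.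
Unset Strict Implicit.
Unset Printing Implicit Defensive.
Import Order.TTheory GRing.Theory Num.Theory.
Import numFieldNormedType.Exports.
Local Open Scope classical_set_scope.
Local Open Scope ring_scope.
Local Open Scope complex_scope.

(* The real line with the sigma-algebra of all Lebesgue-measurable sets, i.e.
   the domain of [completed_lebesgue_measure]; the carrier is [R]. *)
Notation lebesgueTypeR R := (caratheodory_type (@wlength R idfun)^*%mu).

Section poisson.
Context {R : realType}.
Local Notation C := R[i].
Local Notation mu := (@completed_lebesgue_measure R).
Implicit Types (F f : C -> C) (z : C) (r t : R) (p q : \bar R).

Definition cabs z : R := ComplexField.Normc.normc z.

Definition cis t : C := cos t +i* sin t.

Definition disk r : set C := [set z | cabs z < r].

(* [F] is only ever evaluated on the unit circle, through [F (cis t)]. *)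

Definition circle_measurable F : Prop :=
  measurable_fun (`[0, 2 * pi] : set (lebesgueTypeR R))
    (fun t => complex.Re (F (cis t))) /\
  measurable_fun (`[0, 2 * pi] : set (lebesgueTypeR R))
    (fun t => complex.Im (F (cis t))).

(* [g \_ A] is [g] extended by 0 outside [A]. The measure on the circle is [dt],
   not [dt / (2 pi)]. *)
Definition circle_Lnorm p F : \bar R :=
  Lnorm mu p ((fun t => (cabs (F (cis t)))%:E) \_ `[0, 2 * pi]).

Definition circle_Lp p F : Prop :=
  circle_measurable F /\ (circle_Lnorm p F < +oo)%E.

Definition poisson_kernel z : R := (1 - cabs z ^+ 2) / cabs (1 - z) ^+ 2.

(* For z = r e^(i theta), r e^(i (theta - t)) is [z * cis (- t)]. *)
Definition poisson_integral F z : C :=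
  ((2 * pi)^-1 * \int[mu]_(t in `[0, 2 * pi])
     (poisson_kernel (z * cis (- t)) * complex.Re (F (cis t)))) +i*
  ((2 * pi)^-1 * \int[mu]_(t in `[0, 2 * pi])
     (poisson_kernel (z * cis (- t)) * complex.Im (F (cis t)))).

Definition partial_x f z : C :=
  derive1 (fun x : R => complex.Re (f (x +i* complex.Im z))) (complex.Re z) +i*
  derive1 (fun x : R => complex.Im (f (x +i* complex.Im z))) (complex.Re z).

Definition partial_y f z : C :=
  derive1 (fun y : R => complex.Re (f (complex.Re z +i* y))) (complex.Im z) +i*
  derive1 (fun y : R => complex.Im (f (complex.Re z +i* y))) (complex.Im z).

Definition dz f z : C := 2^-1 * (partial_x f z - 'i%C * partial_y f z).

Definition dzbar f z : C := 2^-1 * (partial_x f z + 'i%C * partial_y f z).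

(* [R[i]^o] carries the topology of the norm of [R[i]]. *)
Definition region (Omega : set C) : Prop :=
  [/\ Omega !=set0, open (Omega : set C^o) & connected (Omega : set C^o)].

Definition univalent_on (Omega : set C) f : Prop := set_inj Omega f.

Definition schlicht_disk f (U D : set C) : Prop :=
  exists Omega : set C,
    [/\ region Omega, Omega `<=` U, univalent_on Omega f & f @` Omega = D].

(* The value at -oo is irrelevant: -oo has no Hoelder conjugate in [1, +oo]. *)
Definition Cq q (n : nat) : R :=
  match q with
  | s%:E =>
    ((2 * pi)^-1 * \int[mu]_(t in `[0, 2 * pi]) (`|cos (n%:R * t)| `^ s))
      `^ s^-1
  | _ => 1
  end.

End poisson.

(* Main.v *)
Require Import Defs.
From mathcomp Require Import all_boot all_order all_algebra.
From mathcomp Require Import all_classical all_reals all_analysis.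
From mathcomp Require Import complex measurable_realfun ess_sup_inf.
From mathcomp Require Import ring lra.
(** Put [Lam = 2 C_q ||F||_p].  Writing half the Poisson kernel as
    [1/2 + Re w + Re w^2 + ...] with [w = z e^(-it)] expands the Poisson integral
    as [f z = f 0 + L_1 z + L_2 (z^2) + L_3 (z^3) + ...], where [L_k u] is the
    integral of [Re (u e^(-ikt)) F] divided by [pi].  The map [L_k] is only
    real-linear: it stores the coefficients of both [z^k] and its conjugate.
    After rotating [u] to the positive axis the kernel becomes
    [|u| cos (kt + c)], so Hoelder's inequality, together with the fact that the
    [q]-norm of [cos (kt + c)] over a period depends neither on [k] nor on [c],
    gives [|L_k u| <= Lam |u|] ([cabs_fourier_coef]).

    The normalization says [f 0 = 0] and [L_1 u = u].  Hence [f] is a perturbation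
    of the identity: on the closed disk of radius [r < 1] the map [f - id] is
    Lipschitz with constant [Lam (2 r + 3 r^2 + ...) = Lam ((1 - r)^-2 - 1)], and
    [|f z - z| <= Lam |z|^2 / (1 - |z|)].  The Lipschitz constant drops below 1
    exactly when [(1 - r)^2 > Lam / (Lam + 1)], that is, when [r < r0]; this gives
    injectivity on the disk of radius [r0].

    For the image, the equation [f z = w] is the fixed point problem
    [z = w - (f z - z)].  For [|w| <= rho < R0] its right-hand side contracts some
    closed disk of radius [r < r0] into itself, because
    [r0 - Lam r0^2 / (1 - r0) = R0]; so every [w] in the disk of radius [R0] has a
    preimage ([near_identity_schlicht]).  The preimage of that disk is open since
    [f] is continuous, and it is connected since the inverse of [f] is continuous
    along every radius of the disk.

    Only finitely many terms of the expansion are ever used: the remainder is an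
    integral against [Re (w^(N+1) / (1 - w))], which is uniformly
    [O(|z|^(N+1))], and it disappears in the limit of the inequalities. *)

Import Order.TTheory GRing.Theory Num.Theory.
Import numFieldNormedType.Exports.
Local Open Scope classical_set_scope.
Local Open Scope ring_scope.
Set Implicit Arguments.
Unset Strict Implicit.
Unset Printing Implicit Defensive.

(** * The modulus on the complex plane *)

Section modulus.
Context {R : realType}.
Implicit Types z w : R[i].

Lemma cabs_ge0 z : 0 <= cabs z.
Proof. by case: z => a b; rewrite /cabs /= sqrtr_ge0. Qed.

Lemma cabsM z w : cabs (z * w) = cabs z * cabs w.
Proof. exact: ComplexField.Normc.normcM. Qed.

Lemma cabsX z k : cabs (z ^+ k) = cabs z ^+ k.
Proof.
elim: k => [|k IH]; first exact: ComplexField.Normc.normc1.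
by rewrite !exprS cabsM IH.
Qed.

Lemma cabsD z w : cabs (z + w) <= cabs z + cabs w.
Proof. exact: le_normcD. Qed.

Lemma cabsN z : cabs (- z) = cabs z.
Proof. exact: normcN. Qed.

Lemma cabs_conj z : cabs (z^*)%C = cabs z.
Proof. by case: z => a b; rewrite /cabs /= sqrrN. Qed.

Lemma cabs0 : cabs (0 : R[i]) = 0.
Proof. exact: ComplexField.Normc.normc0. Qed.

Lemma cabs1 : cabs (1 : R[i]) = 1.
Proof. exact: ComplexField.Normc.normc1. Qed.

Lemma cabsV z : cabs z^-1 = (cabs z)^-1.
Proof. exact: ComplexField.Normc.normcV. Qed.

Lemma cabs_eq0 z : cabs z = 0 -> z = 0.
Proof. exact: ComplexField.Normc.eq0_normc. Qed.

Lemma cabsBC z w : cabs (z - w) = cabs (w - z).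
Proof. by rewrite -cabsN opprB. Qed.

Lemma cabsB z w : cabs z - cabs w <= cabs (z - w).
Proof. by rewrite lerBlDr; apply: le_trans (cabsD _ _); rewrite subrK. Qed.

Lemma cabs_sum (I : Type) (s : seq I) (P : pred I) (G : I -> R[i]) :
  cabs (\sum_(i <- s | P i) G i) <= \sum_(i <- s | P i) cabs (G i).
Proof.
elim/big_ind2: _ => [||//]; first by rewrite cabs0.
by move=> x1 x2 y1 y2 h1 h2; apply: le_trans (cabsD _ _) (lerD h1 h2).
Qed.

Lemma cabs_subX z w (r : R) m : cabs z <= r -> cabs w <= r ->
  cabs (z ^+ m.+1 - w ^+ m.+1) <= m.+1%:R * r ^+ m * cabs (z - w).
Proof.
move=> zr wr; have r0 : 0 <= r by exact: le_trans (cabs_ge0 z) zr.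
elim: m => [|m IH]; first by rewrite !expr1 expr0 !mul1r.
have -> : z ^+ m.+2 - w ^+ m.+2 = z * (z ^+ m.+1 - w ^+ m.+1) + (z - w) * w ^+ m.+1.
  by rewrite !exprS; ring.
apply: le_trans (cabsD _ _) _; rewrite !cabsM cabsX.
have -> : m.+2%:R * r ^+ m.+1 * cabs (z - w) =
    r * (m.+1%:R * r ^+ m * cabs (z - w)) + cabs (z - w) * r ^+ m.+1.
  by rewrite -(natr1 m.+1) !exprS; ring.
apply: lerD; first by apply: ler_pM => //; exact: cabs_ge0.
by rewrite ler_wpM2l ?cabs_ge0 // lerXn2r ?nnegrE ?cabs_ge0.
Qed.

Lemma normr_cabs z : `|z| = (cabs z)%:C%C.
Proof. by case: z => a b; rewrite normc_def. Qed.

Lemma sqr_cabs z : cabs z ^+ 2 = complex.Re z ^+ 2 + complex.Im z ^+ 2.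
Proof. by case: z => a b; rewrite /cabs /= sqr_sqrtr ?addr_ge0 ?sqr_ge0. Qed.

Lemma Re_le_cabs z : `|complex.Re z| <= cabs z.
Proof.
by rewrite -ler_sqr ?nnegrE ?cabs_ge0 // sqr_cabs real_normK ?num_real // lerDl sqr_ge0.
Qed.

Lemma Im_le_cabs z : `|complex.Im z| <= cabs z.
Proof.
by rewrite -ler_sqr ?nnegrE ?cabs_ge0 // sqr_cabs real_normK ?num_real // lerDr sqr_ge0.
Qed.

Lemma cabs_le_ReIm z : cabs z <= `|complex.Re z| + `|complex.Im z|.
Proof.
rewrite -ler_sqr ?nnegrE ?cabs_ge0 ?addr_ge0 // sqr_cabs sqrrD.
rewrite !real_normK ?num_real //.
by rewrite [leRHS]addrAC lerDl mulrn_wge0 ?mulr_ge0.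
Qed.

Lemma ReB z w : complex.Re (z - w) = complex.Re z - complex.Re w.
Proof. by case: z; case: w. Qed.

Lemma ImB z w : complex.Im (z - w) = complex.Im z - complex.Im w.
Proof. by case: z; case: w. Qed.

Lemma cabs_real (x : R) : cabs (x%:C%C) = `|x|.
Proof. by rewrite /cabs /= expr0n addr0 sqrtr_sqr. Qed.

Lemma realM_complex (c x y : R) : (c%:C * (x +i* y) = (c * x) +i* (c * y))%C.
Proof. by apply/eqP; rewrite eq_complex /= !mul0r subr0 addr0 !eqxx. Qed.

(** The topology of the complex plane is stated with radii that are
    themselves complex numbers; these two lemmas bring it back to real ones. *)
Lemma open_cabsP (A : set R[i]) :
  (forall z, A z -> exists2 e : R, 0 < e & forall w, cabs (z - w) < e -> A w) ->
  open (A : set R[i]^o).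
Proof.
move=> hA; rewrite openE => z /hA [e e0 he].
rewrite /interior; apply/nbhs_ballP; exists (e%:C)%C => /=; first by rewrite ltcR.
by move=> w /=; rewrite -ball_normE /= normr_cabs ltcR; exact: he.
Qed.

Lemma cvg_cabsP (T : Type) (G : set_system T) {FG : Filter G} (h : T -> R[i]) z :
  (forall e : R, 0 < e -> \forall t \near G, cabs (z - h t) < e) ->
  (h : T -> R[i]^o) t @[t --> G] --> (z : R[i]^o).
Proof.
move=> hz; apply/cvgrPdist_lt => e.
case: e => a b; rewrite ltcE /= => /andP[/eqP -> a0].
apply: filterS (hz _ a0) => t.
by rewrite normr_cabs ltcE /= eqxx.
Qed.

End modulus.

(** * Perturbations of the identity *)

Section fixed_point.
Context {R : realType}.
Implicit Types (z w : R[i]) (g f : R[i] -> R[i]).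

Lemma cvg_of_geometric (a k : R) (u : nat -> R) : 0 <= k < 1 -> u 0 = 0 ->
  (forall n, `|u n.+1 - u n| <= a * k ^+ n) -> exists l : R, u @ \oo --> l.
Proof.
move=> /andP[k0 k1] u0 hu; exists (limn u).
have -> : u = series (telescope u).
  by rewrite telescopeK; apply/funext => n /=; rewrite u0 subr0.
apply: (@normed_cvg R R); apply: (@series_le_cvg _ _ (geometric a k)) => [n|n|n|].
- exact: normr_ge0.
- by apply: le_trans (hu n); exact: normr_ge0.
- exact: hu.
- by apply: is_cvg_geometric_series; rewrite ger0_norm.
Qed.

(** Completeness is only used for real sequences: the iterates converge because
    their real and imaginary parts do. *)
Lemma contraction_fixed_point (r k : R) g : 0 <= k < 1 -> 0 <= r ->
  (forall z w, cabs z <= r -> cabs w <= r ->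
     cabs (g z - g w) <= k * cabs (z - w)) ->
  (forall z, cabs z <= r -> cabs (g z) <= r) ->
  exists2 z, cabs z <= r & g z = z.
Proof.
move=> k01 r0 hg gr; have /andP[k0 k1] := k01.
pose u n := iter n g 0.
have ur n : cabs (u n) <= r by elim: n => [|n]; rewrite ?cabs0 //; exact: gr.
have du n : cabs (u n.+1 - u n) <= r * k ^+ n.
  elim: n => [|n IH]; first by rewrite expr0 mulr1 subr0; exact: (ur 1%N).
  apply: (le_trans (hg (u n.+1) (u n) (ur _) (ur _))).
  by rewrite exprS mulrCA ler_wpM2l.
have [a ha] : exists a : R, (fun n => complex.Re (u n)) @ \oo --> a.
  apply: (@cvg_of_geometric r k) => // n; rewrite -ReB.
  by apply: le_trans (du n); exact: Re_le_cabs.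
have [b hb] : exists b : R, (fun n => complex.Im (u n)) @ \oo --> b.
  apply: (@cvg_of_geometric r k) => // n; rewrite -ImB.
  by apply: le_trans (du n); exact: Im_le_cabs.
pose z := (a +i* b)%C.
have near_z e : 0 < e -> exists N, forall n, (N <= n)%N -> cabs (z - u n) < e.
  move=> e0; have e20 : 0 < e / 2 by rewrite divr_gt0.
  have /cvgrPdist_lt /(_ _ e20) [N1 _ h1] := ha.
  have /cvgrPdist_lt /(_ _ e20) [N2 _ h2] := hb.
  exists (maxn N1 N2) => n; rewrite geq_max => /andP[n1 n2].
  apply: (le_lt_trans (cabs_le_ReIm _)); rewrite ReB ImB [e]splitr.
  by apply: ltrD; [exact: h1|exact: h2].
have zr : cabs z <= r.
  apply/ler_addgt0Pr => e e0; have [N /(_ N (leqnn _)) hN] := near_z _ e0.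
  rewrite -[z](subrK (u N)) addrC; apply: (le_trans (cabsD _ _)).
  by rewrite addrC [leRHS]addrC lerD // ltW.
exists z => //; apply/eqP; rewrite -subr_eq0; apply/eqP/cabs_eq0/eqP.
rewrite eq_le cabs_ge0 andbT; apply/ler_addgt0Pr => e e0; rewrite add0r.
have e20 : 0 < e / 2 by rewrite divr_gt0.
have [N hN] := near_z _ e20.
have -> : g z - z = (g z - g (u N)) + (u N.+1 - z) by rewrite /= addrA subrK.
apply: (le_trans (cabsD _ _)); rewrite [e]splitr; apply: lerD.
  apply: (le_trans (hg _ _ zr (ur _))); apply: le_trans (ltW (hN N (leqnn _))).
  by rewrite ler_piMl ?cabs_ge0 // ltW.
by rewrite cabsBC ltW // hN.
Qed.

End fixed_point.

Section near_identity.
Context {R : realType}.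
Variables (f : R[i] -> R[i]) (r0 R0 : R).
Hypothesis R0_gt0 : 0 < R0.
Hypothesis f_contr : forall r, 0 <= r < r0 -> exists2 k, 0 <= k < 1 &
  forall z w, cabs z <= r -> cabs w <= r ->
    cabs ((f z - z) - (f w - w)) <= k * cabs (z - w).
Hypothesis f_small : forall rho, 0 <= rho < R0 -> exists2 r, 0 <= r < r0 &
  forall z, cabs z <= r -> cabs (f z - z) <= r - rho.

Let f_expand r : 0 <= r < r0 -> exists2 c, 0 < c &
  forall z w, cabs z <= r -> cabs w <= r -> c * cabs (z - w) <= cabs (f z - f w).
Proof.
move=> /f_contr[k /andP[k0 k1] hk]; exists (1 - k); first by rewrite subr_gt0.
move=> z w zr wr; rewrite mulrBl mul1r.
apply: (@le_trans _ _ (cabs (z - w) - cabs ((f z - z) - (f w - w)))).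
  by rewrite lerD2l lerN2 hk.
rewrite -(cabsN (_ - _ - _)); apply: le_trans (cabsB _ _) _.
by rewrite le_eqVlt; apply/orP; left; apply/eqP; congr cabs; ring.
Qed.

Let f_lipschitz r : 0 <= r < r0 ->
  forall z w, cabs z <= r -> cabs w <= r -> cabs (f z - f w) <= 2 * cabs (z - w).
Proof.
move=> /f_contr[k /andP[k0 k1] hk] z w zr wr.
have -> : f z - f w = (z - w) + ((f z - z) - (f w - w)) by ring.
apply: (le_trans (cabsD _ _)); rewrite mulrDl mul1r lerD2l.
by apply: (le_trans (hk _ _ zr wr)); rewrite ler_piMl ?cabs_ge0 // ltW.
Qed.

Lemma near_identity_inj : univalent_on (disk r0) f.
Proof.
move=> z w; rewrite /disk !inE /= => zr wr fzw.
pose r := Num.max (cabs z) (cabs w).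
have r01 : 0 <= r < r0 by rewrite le_max cabs_ge0 /= gt_max zr wr.
have [c c0 hc] := f_expand r01.
apply/eqP; rewrite -subr_eq0; apply/eqP/cabs_eq0/eqP.
rewrite eq_le cabs_ge0 andbT -(pmulr_rle0 _ c0).
have -> : 0 = cabs (f z - f w) by rewrite fzw subrr cabs0.
by apply: hc; rewrite le_max lexx ?orbT.
Qed.

Let f_onto rho : 0 <= rho < R0 -> exists2 r, 0 <= r < r0 &
  forall w, cabs w <= rho -> exists2 z, cabs z <= r & f z = w.
Proof.
move=> hrho; have [r hr fr] := f_small hrho; exists r => // w wrho.
have [k k01 hk] := f_contr hr; have /andP[r_ge0 _] := hr.
have [||z zr hz] := @contraction_fixed_point _ r k (fun z => w - (f z - z)) k01 r_ge0.
- move=> z z' zr zr'.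
  have -> : w - (f z - z) - (w - (f z' - z')) = - ((f z - z) - (f z' - z')) by ring.
  by rewrite cabsN hk.
- move=> z zr; apply: (le_trans (cabsD _ _)); rewrite cabsN.
  by apply: (le_trans (lerD wrho (fr _ zr))); rewrite subrKC.
exists z => //; have : w - (f z - z) + (f z - z) = w by rewrite subrK.
by rewrite hz subrKC.
Qed.

Let inv_ex w : disk R0 w -> exists z, cabs z < r0 /\ f z = w.
Proof.
move=> wR; have wR' : 0 <= cabs w < R0 by rewrite cabs_ge0.
have [r /andP[_ rr0] hr] := f_onto wR'.
by have [z zr fz] := hr _ (lexx _); exists z; split => //; apply: le_lt_trans rr0.
Qed.

(** The schlicht region is the preimage [Om] of the disk of radius [R0].  It is a
    union of the curves [t |-> h (t w)], where [h] is the inverse of [f]; they all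
    pass through [h 0], so continuity of each one makes [Om] connected. *)
Lemma near_identity_schlicht : schlicht_disk f (disk r0) (disk R0).
Proof.
have [h hP] : {h : R[i] -> R[i] & forall w, cabs w < R0 -> cabs (h w) < r0 /\ f (h w) = w}.
  apply: (@choice _ _ (fun w z => cabs w < R0 -> cabs z < r0 /\ f z = w)) => w.
  have [wR|wR] := pselect (cabs w < R0); last by exists 0.
  by have [z hz] := inv_ex wR; exists z.
pose Om : set R[i] := [set z | cabs z < r0 /\ cabs (f z) < R0].
have scale_lt (w : R[i]) (t : R) : 0 <= t <= 1 -> cabs ((t%:C)%C * w) <= cabs w.
  by move=> /andP[t0 t1]; rewrite cabsM cabs_real ger0_norm // ler_piMl ?cabs_ge0.
have h_f z : Om z -> h (f z) = z.
  move=> [zr fzR]; have [hr fh] := hP _ fzR.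
  by apply: near_identity_inj => //; rewrite inE.
exists Om; split.
- split.
  + have h00 : disk R0 (0 : R[i]) by rewrite /disk /mkset cabs0.
    by have [hr fh] := hP _ h00; exists (h 0); split => //; rewrite fh cabs0.
  + apply: open_cabsP => z [zr fzR].
    pose r := (cabs z + r0) / 2.
    have zr' : cabs z < r by rewrite /r; lra.
    have rr0 : 0 <= r < r0 by have := cabs_ge0 z; rewrite /r; lra.
    (* Staying within [r] keeps [w] in the region where [f] is 2-Lipschitz. *)
    pose d := Num.min (r - cabs z) ((R0 - cabs (f z)) / 2).
    exists d; first by rewrite lt_min subr_gt0 zr' /= divr_gt0 ?subr_gt0.
    move=> w; rewrite lt_min => /andP[zw1 zw2].
    have wr : cabs w < r by have := cabsB w z; rewrite cabsBC; lra.
    split; first by apply: lt_trans wr _; case/andP: rr0.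
    have := f_lipschitz rr0 (ltW zr') (ltW wr).
    by have := cabsB (f w) (f z); rewrite cabsBC; lra.
  + pose seg w : set R[i] := [set h ((t%:C)%C * w) | t in (`[0, 1] : set R)].
    have -> : Om = \bigcup_(w in disk R0) seg w.
      apply/seteqP; split => [z [zr fzR]|_ [w wR [t /= t01 <-]]].
        exists (f z) => //; exists 1; first by rewrite /= in_itv /= lexx ler01.
        by rewrite mul1r; apply: h_f.
      have twR : cabs ((t%:C)%C * w) < R0.
        by apply: le_lt_trans wR; apply: scale_lt; rewrite in_itv /= in t01.
      by have [hr fh] := hP _ twR; split => //; rewrite fh.
    apply: (@bigcup_connected R[i]^o).
      exists (h 0) => w wR; exists 0; first by rewrite /= in_itv /= lexx ler01.
      by rewrite mul0r.
    move=> w wR.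
    apply: (@connected_continuous_connected R R[i]^o _ (fun t : R => h ((t%:C)%C * w))).
      exact: segment_connected.
    have w_int : 0 <= cabs w < R0 by rewrite cabs_ge0.
    have [r rr0 hr] := f_onto w_int; have [c c0 hc] := f_expand rr0.
    (* The curve stays in a closed disk smaller than [r0], where [f] expands
       distances by a uniform factor [c], so [h] is Lipschitz along it. *)
    have h_le t : 0 <= t <= 1 -> cabs (h ((t%:C)%C * w)) <= r.
      move=> t01; have [z zr fz] := hr _ (scale_lt w t t01).
      rewrite -fz h_f //; split; last by rewrite fz; apply: le_lt_trans wR; exact: scale_lt.
      by apply: le_lt_trans zr _; case/andP: rr0.
    apply/subspace_continuousP => t /=; rewrite in_itv /= => t01.
    apply: cvg_cabsP => e e0.
    have d0 : 0 < c * e / (cabs w + 1).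
      by rewrite divr_gt0 ?mulr_gt0 // ltr_wpDl ?cabs_ge0.
    rewrite near_withinE; near=> s => /=; rewrite in_itv /= => s01.
    have ts : `|t - s| < c * e / (cabs w + 1).
      near: s; have := @nbhsx_ballx _ R t _ d0.
      by apply: filterS => s; rewrite -ball_normE.
    rewrite -(ltr_pM2l c0); apply: (le_lt_trans (hc _ _ (h_le _ t01) (h_le _ s01))).
    have fh u : 0 <= u <= 1 -> f (h ((u%:C)%C * w)) = (u%:C)%C * w.
      move=> u01; have uwR : cabs ((u%:C)%C * w) < R0.
        by apply: le_lt_trans wR; exact: scale_lt.
      by case: (hP _ uwR).
    rewrite !fh // -mulrBl -rmorphB /= cabsM cabs_real.
    move: ts; rewrite ltr_pdivlMr ?ltr_wpDl ?cabs_ge0 //; apply: le_lt_trans.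
    by rewrite ler_wpM2l // lerDl.
- by move=> z [].
- by move=> z w; rewrite !inE => -[zr _] [wr _]; apply: near_identity_inj; rewrite inE.
- apply/seteqP; split => [_ [z [zr fzR] <-]//|w wR].
  by have [hr fh] := hP _ wR; exists (h w) => //; split => //; rewrite fh.
Unshelve. all: by end_near.
Qed.

End near_identity.

Section bloch_radius.
Context {R : realType}.
Variables (f : R[i] -> R[i]) (Lam s : R).
Hypotheses (Lam_gt0 : 0 < Lam) (s_gt0 : 0 < s) (sE : s ^+ 2 * (Lam + 1) = Lam).
Hypothesis f_small : forall z, cabs z < 1 ->
  cabs (f z - z) <= Lam * (cabs z ^+ 2 / (1 - cabs z)).
Hypothesis f_contr : forall (r : R) z w, r < 1 -> cabs z <= r -> cabs w <= r ->
  cabs ((f z - z) - (f w - w)) <= Lam * ((1 - r) ^- 2 - 1) * cabs (z - w).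

(** The equation [s^2 = Lam / (Lam + 1)] says that the Lipschitz constant
    [Lam ((1 - r)^-2 - 1)] reaches 1 exactly at [r = 1 - s]. *)
Lemma bloch_radius : univalent_on (disk (1 - s)) f /\
  schlicht_disk f (disk (1 - s)) (disk (1 - s - Lam * (1 - s) ^+ 2 / s)).
Proof.
have Lam1_gt0 : 0 < Lam + 1 by rewrite addr_gt0.
have s_lt1 : s < 1.
  rewrite -(@expr_lt1 _ 2) ?ltW //.
  by rewrite -(ltr_pM2r Lam1_gt0) sE mul1r ltrDl.
set r0 := 1 - s; have r0_gt0 : 0 < r0 by rewrite subr_gt0.
set R0 := r0 - _.
have R0E : R0 = (s - Lam * r0) * r0 / s by rewrite /R0; field; rewrite gt_eqF.
have R0_gt0 : 0 < R0.
  rewrite R0E divr_gt0 // mulr_gt0 // /r0.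
  have -> : s - Lam * (1 - s) = s * (Lam + 1) * (1 - s).
    have -> : s * (Lam + 1) * (1 - s) = s * (Lam + 1) - s ^+ 2 * (Lam + 1) by ring.
    by rewrite sE; ring.
  by rewrite mulr_gt0 ?subr_gt0 // mulr_gt0.
have contr r : 0 <= r < r0 -> exists2 k, 0 <= k < 1 &
    forall z w, cabs z <= r -> cabs w <= r ->
    cabs ((f z - z) - (f w - w)) <= k * cabs (z - w).
  move=> /andP[r_ge0 rr0]; exists (Lam * ((1 - r) ^- 2 - 1)); last first.
    by move=> z w; apply: f_contr; apply: lt_trans rr0 _; rewrite /r0 ltrBlDr ltrDl.
  have sr : s < 1 - r by move: rr0; rewrite /r0; lra.
  have d0 : 0 < 1 - r by exact: lt_trans sr.
  apply/andP; split.
    rewrite mulr_ge0 ?(ltW Lam_gt0) // subr_ge0 invf_ge1 ?exprn_gt0 //.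
    by rewrite exprn_ile1 ?(ltW d0) // lerBlDr lerDl.
  rewrite mulrC -ltr_pdivlMr // mul1r ltrBlDr.
  have -> : Lam^-1 + 1 = s ^- 2.
    have -> : Lam^-1 + 1 = (Lam + 1) / Lam by field; rewrite gt_eqF.
    by rewrite -[X in _ / X]sE invfM mulrCA mulfV ?mulr1 // gt_eqF.
  by rewrite ltf_pV2 ?posrE ?exprn_gt0 // ltrXn2r // ltW.
have small rho : 0 <= rho < R0 -> exists2 r, 0 <= r < r0 &
    forall z, cabs z <= r -> cabs (f z - z) <= r - rho.
  move=> /andP[rho0 rhoR].
  have m_ge0 : 0 <= Lam * r0 ^+ 2 / s.
    by rewrite divr_ge0 ?(ltW s_gt0) // mulr_ge0 ?(ltW Lam_gt0) // exprn_ge0 // ltW.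
  (* This radius is [r0 - (R0 - rho)]; the bound on [f z - z] at [r0] already
     suffices on the smaller disk. *)
  exists (rho + Lam * r0 ^+ 2 / s); first by move: rhoR; rewrite /R0 addr_ge0 //; lra.
  move=> z zr; rewrite [leRHS]addrAC subrr add0r.
  have zr0 : cabs z <= r0 by move: rhoR zr; rewrite /R0; lra.
  have zs : s <= 1 - cabs z by move: zr0; rewrite /r0; lra.
  apply: le_trans (f_small _) _; first by move: zr0 s_gt0; rewrite /r0; lra.
  rewrite -mulrA ler_wpM2l ?(ltW Lam_gt0) //.
  apply: ler_pM; rewrite ?exprn_ge0 ?cabs_ge0 ?invr_ge0 //; first by move: zs s_gt0; lra.
    by rewrite lerXn2r ?nnegrE ?cabs_ge0 // ltW.
  by rewrite lef_pV2 // posrE //; move: zs s_gt0; lra.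
split; first exact: near_identity_inj contr.
exact: near_identity_schlicht R0_gt0 contr small.
Qed.

End bloch_radius.

(** * Integrals of dilated periodic functions *)

Section periodic_integral.
Context {R : realType}.
Local Notation leb := (@lebesgue_measure R).
Implicit Types (G H : R -> R).

Lemma continuous_primitive G (a b : R) : continuous G ->
  exists H, forall x, a < x < b -> is_derive x 1 H (G x).
Proof.
move=> cG; exists (fun x => \int[leb]_(t in `[a, x]) G t) => x /andP[ax xb].
have Gi : leb.-integrable `[a, b] (EFin \o G).
  apply: continuous_compact_integrable; first exact: segment_compact.
  exact: continuous_subspaceT.
have [dH HE] := continuous_FTC1_closed xb Gi ax (cG x).
apply: DeriveDef; first exact: dH.
by rewrite -derive1E; exact: HE.
Qed.

Lemma is_derive_continuous H (x l : R) : is_derive x 1 H l -> {for x, continuous H}.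
Proof. by move=> [dH _]; apply: differentiable_continuous; exact/derivable1_diffP. Qed.

Lemma is_derive_affine (k c x : R) : is_derive x 1 (fun t : R => k * t + c) k.
Proof.
have := @is_deriveD _ _ _ (fun t => k * t) (fun=> c) x 1 k 0.
rewrite addr0; apply.
have := @is_deriveZ _ _ _ (@id R) k x 1 1.
by rewrite /GRing.scale /= mulr1; apply; exact: is_derive_id.
Qed.

Lemma integral_affine G H (a b k c : R) : continuous G -> a < b -> 0 < k ->
  (forall x, k * a + c <= x <= k * b + c -> is_derive x 1 H (G x)) ->
  k * \int[leb]_(t in `[a, b]) G (k * t + c) = H (k * b + c) - H (k * a + c).
Proof.
move=> cG ab k0 dH.
pose P t := H (k * t + c).
have dP t : a <= t <= b -> is_derive t 1 P (k * G (k * t + c)).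
  move=> /andP[at_ tb]; rewrite mulrC.
  apply: (@is_derive1_comp _ H (fun t => k * t + c)); last exact: is_derive_affine.
  by apply: dH; rewrite !lerD2r !ler_pM2l // at_.
have cGl : continuous (fun t : R => G (k * t + c)).
  move=> t; apply: (@continuous_comp _ _ _ (fun t => k * t + c) G); last exact: cG.
  exact: is_derive_continuous (is_derive_affine k c t).
have ci : leb.-integrable `[a, b] (EFin \o (fun t => G (k * t + c))).
  apply: continuous_compact_integrable; first exact: segment_compact.
  exact: continuous_subspaceT.
rewrite -RintegralZl // /Rintegral (@continuous_FTC2 _ _ P) //.
- by apply: continuous_subspaceT => t; apply: cvgM; [exact: cvg_cst|exact: cGl].
- split.
  + by move=> t; rewrite in_itv /= => /andP[/ltW ? /ltW ?]; case: (dP t) => //; apply/andP.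
  + by apply: cvg_at_right_filter; apply: is_derive_continuous (dP a _); rewrite lexx ltW.
  + by apply: cvg_at_left_filter; apply: is_derive_continuous (dP b _); rewrite lexx ltW.
- move=> t; rewrite in_itv /= => /andP[/ltW ? /ltW ?].
  by rewrite derive1E; apply: derive_val; apply: dP; apply/andP.
Qed.


(** The substitution [x = m t + c] spreads the integral over [m] periods, all of
    which contribute the same amount. *)
Lemma integral_periodic_dilate G (p c : R) (m : nat) : continuous G -> 0 < p ->
  (forall x, G (x + p) = G x) -> (0 < m)%N ->
  \int[leb]_(t in `[0, p]) G (m%:R * t + c) = \int[leb]_(t in `[0, p]) G t.
Proof.
move=> cG p0 Gp m0.
have m0' : 0 < m%:R :> R by rewrite ltr0n.
have mp0 : 0 < m%:R * p by rewrite mulr_gt0.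
(* All points met below lie between [- K] and [K]. *)
pose K := `|c| + m%:R * p + p.
have cK : - `|c| <= c <= `|c| by rewrite -ler_norml.
have [H dH] := continuous_primitive (- K - 1) (K + 1) cG.
(* The increment of [H] over one period is constant, since its derivative
   [G (x + p) - G x] vanishes. *)
have incr x : - `|c| <= x <= `|c| + m%:R * p -> H (x + p) - H x = H p - H 0.
  move=> /andP[x1 x2].
  have dD y : - `|c| <= y <= `|c| + m%:R * p ->
      is_derive y 1 (fun y => H (y + p) - H y) 0.
    move=> /andP[y1 y2].
    have -> : (0 : R) = G (y + p) * 1 - G y by rewrite mulr1 Gp subrr.
    apply: is_deriveB; last by apply: dH; rewrite /K; lra.
    apply: (@is_derive1_comp _ H (fun y => y + p)); first by apply: dH; rewrite /K; lra.
    have := is_derive_affine 1 p y.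
    by under eq_fun do rewrite mul1r.
  have cst a b : - `|c| <= a -> a <= b -> b <= `|c| + m%:R * p ->
      H (b + p) - H b = H (a + p) - H a.
    move=> ca ab bc; apply/eqP; rewrite -subr_eq0.
    have [||d _ ->] := @MVT_segment _ (fun y => H (y + p) - H y) (fun=> 0) a b ab.
    - by move=> y; rewrite in_itv /= => /andP[y1 y2]; apply: dD; lra.
    - apply: derivable_within_continuous => y; rewrite in_itv /= => /andP[y1 y2].
      by have [] := dD y; first by lra.
    by rewrite mul0r.
  have [x0|x0] := leP 0 x; first by rewrite (cst 0 x) // ?add0r; lra.
  by rewrite -(cst x 0) ?add0r //; lra.
have telesc k : (k <= m)%N -> H (k%:R * p + c) - H c = k%:R * (H p - H 0).
  elim: k => [|k IH km]; first by rewrite !mul0r add0r subrr.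
  have kp : 0 <= k%:R * p <= m%:R * p.
    by rewrite mulr_ge0 ?ler0n ?(ltW p0) //= ler_pM2r // ler_nat ltnW.
  have -> : k.+1%:R * p + c = (k%:R * p + c) + p by rewrite -natr1; ring.
  rewrite -natr1 mulrDl mul1r -(IH (ltnW km)) -(incr (k%:R * p + c)); last by lra.
  ring.
apply: (mulfI (lt0r_neq0 m0')).
have dHm x : m%:R * 0 + c <= x <= m%:R * p + c -> is_derive x 1 H (G x).
  by rewrite mulr0 add0r => hx; apply: dH; rewrite /K; lra.
have dH1 x : 1 * 0 + 0 <= x <= 1 * p + 0 -> is_derive x 1 H (G x).
  by move=> hx; apply: dH; rewrite /K; have := normr_ge0 c; lra.
rewrite (integral_affine cG p0 m0' dHm) mulr0 add0r telesc //; congr (_ * _).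
have := integral_affine cG p0 ltr01 dH1.
under eq_Rintegral do rewrite mul1r addr0.
by rewrite !mul1r !addr0.
Qed.

End periodic_integral.

Section cosine_power.
Context {R : realType}.
Local Notation leb := (@lebesgue_measure R).

(** The power function is differentiable away from 0; at 0 it is squeezed by
    [|x|], as [s >= 1]. *)
Lemma continuous_normr_powR (s : R) : 1 <= s -> continuous (fun x : R => `|x| `^ s).
Proof.
move=> s1 x; have s0 : s != 0 by rewrite gt_eqF // (lt_le_trans ltr01).
have [->|x0] := eqVneq x 0.
  rewrite /continuous_at normr0 powR0 //.
  apply: (@squeeze_cvgr _ _ _ _ (fun=> 0) (fun x => `|x|)).
  - near=> y; rewrite powR_ge0 /=.
    have y1 : `|y| < 1.
      near: y; have := @nbhsx_ballx _ R 0 1 ltr01.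
      by apply: filterS => y; rewrite -ball_normE /= sub0r normrN.
    have [->|y0] := eqVneq y 0; first by rewrite normr0 powR0.
    by apply: ge1r_powR => //; rewrite normr_gt0 y0 ltW.
  - exact: cvg_cst.
  - by rewrite -[X in _ --> X](normr0 R); apply: cvg_norm; exact: cvg_id.
apply: (@continuous_comp _ _ _ (fun x : R => `|x|) (fun y => y `^ s)).
  exact: norm_continuous.
have := @is_derive1_powR R s `|x|; rewrite normr_gt0 => /(_ x0).
exact: is_derive_continuous.
Unshelve. all: by end_near.
Qed.

Lemma continuous_cos_affine (a c : R) : continuous (fun t : R => cos (a * t + c)).
Proof.
move=> t; apply: (@continuous_comp _ _ _ (fun t => a * t + c) cos).
  exact: is_derive_continuous (is_derive_affine a c t).
exact: continuous_cos.
Qed.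

Lemma continuous_cos_powR (s a c : R) : 1 <= s ->
  continuous (fun t : R => `|cos (a * t + c)| `^ s).
Proof.
move=> s1 t.
apply: (@continuous_comp _ _ _ (fun t => cos (a * t + c)) (fun y => `|y| `^ s)).
  exact: continuous_cos_affine.
exact: continuous_normr_powR.
Qed.

Lemma integral_cos_powR (s c : R) (m n : nat) : 1 <= s -> (0 < m)%N -> (0 < n)%N ->
  \int[leb]_(t in `[0, 2 * pi]) (`|cos (m%:R * t + c)| `^ s) =
  \int[leb]_(t in `[0, 2 * pi]) (`|cos (n%:R * t)| `^ s).
Proof.
move=> s1 m0 n0; pose G t := `|cos t : R| `^ s.
have cG : continuous G.
  move=> t; apply: (@continuous_comp _ _ _ (@cos R) (fun y => `|y| `^ s)).
    exact: continuous_cos.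
  exact: continuous_normr_powR.
have p0 : 0 < 2 * pi :> R by rewrite mulr_gt0 ?pi_gt0.
have Gp x : G (x + 2 * pi) = G x by rewrite /G mulr_natl cosD2pi.
have Em := integral_periodic_dilate c cG p0 Gp m0.
have := integral_periodic_dilate 0 cG p0 Gp n0.
under eq_Rintegral do rewrite addr0.
by move=> En; exact: etrans Em (esym En).
Qed.

End cosine_power.

(** * Borel functions and the completed Lebesgue measure *)

Section completed.
Context {R : realType}.
Local Notation leb := (@lebesgue_measure R).
Local Notation mu := (@completed_lebesgue_measure R).
Local Notation T := (lebesgueTypeR R).

Lemma measurable_borel_lebesgue (A : set (measurableTypeR R)) :
  measurable A -> measurable (A : set T).
Proof. by move=> mA; apply: sub_caratheodory. Qed.

Lemma measurable_fun_borel_lebesgue (D : set (measurableTypeR R)) (h : R -> R) :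
  measurable D -> measurable_fun (D : set (measurableTypeR R)) h ->
  measurable_fun (D : set T) (h : T -> R).
Proof.
move=> mD mh _ B mB; apply: measurable_borel_lebesgue; exact: mh.
Qed.

Lemma continuous_measurable_lebesgue (D : set T) (h : R -> R) :
  measurable D -> continuous h -> measurable_fun D (h : T -> R).
Proof.
move=> mD ch; apply: (@measurable_funS _ _ T R setT) => //.
apply: measurable_fun_borel_lebesgue => //.
exact: measurable_realfun.continuous_measurable_fun.
Qed.

(** The Lebesgue measure is the image of its completion under the identity map,
    which is measurable from the completed sigma-algebra to the Borel one. *)
Lemma ge0_integral_completed (D : set (measurableTypeR R))
    (h : measurableTypeR R -> \bar R) :
  measurable D -> measurable_fun D h -> (forall t, 0 <= h t)%E ->
  (\int[mu]_(t in (D : set T)) h t = \int[leb]_(t in D) h t)%E.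
Proof.
move=> mD mh h0.
have mid : measurable_fun [set: T] (idfun : T -> measurableTypeR R).
  by move=> _ B mB; rewrite setTI; exact: measurable_borel_lebesgue.
have := @ge0_integral_pushforward _ _ T (measurableTypeR R) R idfun mid mu D h mD mh (fun y _ => h0 y).
rewrite preimage_id => <-.
by apply: eq_measure_integral.
Qed.

End completed.

(** * Hoelder's inequality for all conjugate exponents *)

Section hoelder_bounded.
Context d (T : measurableType d) (R : realType) (mu : {measure set T -> \bar R}).
Variable D : set T.
Hypotheses (mD : measurable D) (muD_gt0 : (0 < mu D)%E) (muD : (mu D < +oo)%E).
Implicit Types (h V A B : T -> R) (p q : \bar R).

(** For finite [q] this is the [q]-norm of [h] over [D]; for [q] infinite it is the
    bound 1 that holds for all the kernels to which it is applied. *)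
Definition kernel_norm q h : R :=
  match q with
  | s%:E => (\int[mu]_(t in D) (`|h t| `^ s)) `^ s^-1
  | _ => 1
  end.

Lemma integrable_bounded h (b : R) : measurable_fun D h ->
  (forall t, D t -> `|h t| <= b) -> mu.-integrable D (EFin \o h).
Proof.
move=> mh hb; apply: (@le_integrable _ _ _ mu D mD _ (EFin \o cst b)).
- exact/measurable_EFinP.
- by move=> t Dt; rewrite /= lee_fin (le_trans (hb t Dt)) // ler_norm.
- apply/integrableP; split; first exact/measurable_EFinP/measurable_cst.
  by rewrite /= integral_cst // lte_mul_pinfty.
Qed.

Lemma fin_num_integral_bounded h (b : R) : measurable_fun D h ->
  (forall t, 0 <= h t) -> (forall t, D t -> h t <= b) ->
  (\int[mu]_(t in D) (h t)%:E)%E = (\int[mu]_(t in D) h t)%:E.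
Proof.
move=> mh h0 hb; rewrite /Rintegral fineK //.
by apply: integrable_fin_num => //; apply: (integrable_bounded (b := b)) => // t Dt; rewrite ger0_norm // hb.
Qed.

(** For [1 < p < +oo] this is the usual inequality, for [p = 1] it is
    [|h| <= 1], and for [p = +oo] it is [V <= ess sup V] almost everywhere. *)
Lemma hoelder_bounded p q h V : measurable_fun D h -> measurable_fun D V ->
  (forall t, `|h t| <= 1) -> (forall t, 0 <= V t) ->
  (1 <= p)%E -> (p^-1 + q^-1 = 1)%E ->
  (Lnorm mu p ((EFin \o V) \_ D) < +oo)%E ->
  (\int[mu]_(t in D) (`|h t| * V t)%:E <=
   (kernel_norm q h * fine (Lnorm mu p ((EFin \o V) \_ D)))%:E)%E.
Proof.
move=> mh mV h1 V0 p1 pq; set N := Lnorm _ _ _ => Noo.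
have N0 : (0 <= N)%E by exact: Lnorm_ge0.
have NE : (fine N)%:E = N by rewrite fineK // ge0_fin_numE.
have mhn : measurable_fun D (fun t => `|h t|) by exact: measurableT_comp.
have mhV : measurable_fun D (fun t => (`|h t| * V t)%:E).
  by apply/measurable_EFinP; exact: measurable_funM.
have mVe : measurable_fun D (fun t => (V t)%:E) by exact/measurable_EFinP.
have mhe : measurable_fun D (fun t => `|h t|%:E) by exact/measurable_EFinP.
have hV0 t : (0 <= (`|h t| * V t)%:E)%E by rewrite lee_fin mulr_ge0.
rewrite EFinM NE.
move: p1 pq @N N0 Noo NE; case: p => [r| |//].
- rewrite lee_fin => r1 rq N N0 Noo NE.
  have r0 : 0 < r by exact: lt_le_trans ltr01 r1.
  have NV : N = ((\int[mu]_(t in D) (V t `^ r)%:E) `^ r^-1)%E.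
    rewrite /N unlock [in RHS]integral_mkcond; congr (_ `^ _)%E; apply: eq_integral => t _.
    rewrite /= /patch; case: ifP => _ /=; first by rewrite ger0_norm.
    by rewrite normr0 powR0 // gt_eqF.
  move: rq; rewrite inver gt_eqF //; case: q => [s| |].
  + rewrite inver; case: eqP => [->|/eqP s0]; first by [].
    rewrite -EFinD => -[rs].
    have s_gt0 : 0 < s.
      rewrite -invr_gt0 lt_neqAle eq_sym invr_eq0 s0 /=.
      by rewrite -(addKr r^-1 s^-1) rs addrC subr_ge0 invf_le1.
    have mhD : measurable_fun [set: T] (h \_ D) by exact: (measurable_restrictT h mD).1.
    have mVD : measurable_fun [set: T] (V \_ D) by exact: (measurable_restrictT V mD).1.
    have sr : s^-1 + r^-1 = 1 by rewrite addrC.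
    have := hoelder mu mhD mVD s_gt0 r0 sr.
    rewrite Lnorm1.
    have -> : (\int[mu]_x `|(EFin \o ((h \_ D) \* (V \_ D))%R) x| =
               \int[mu]_(t in D) (`|h t| * V t)%:E)%E.
      rewrite [RHS]integral_mkcond; apply: eq_integral => t _.
      rewrite /= /patch; case: ifP => _ /=; last by rewrite mul0r normr0.
      by rewrite normrM (ger0_norm (V0 t)).
    have -> : Lnorm mu r%:E (EFin \o (V \_ D)) = N by rewrite /N restrict_EFin.
    suff -> : Lnorm mu s%:E (EFin \o (h \_ D)) = (kernel_norm s%:E h)%:E by [].
    rewrite unlock /kernel_norm -poweR_EFin -(@fin_num_integral_bounded _ 1).
    * rewrite [in RHS]integral_mkcond; congr (_ `^ _)%E; apply: eq_integral => t _.
      rewrite /= /patch; case: ifP => _ //=.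
      by rewrite normr0 powR0.
    * exact: (measurableT_comp (measurable_powR _)).
    * by move=> t; exact: powR_ge0.
    * move=> t _; have <- : 1 `^ s = 1 :> R by rewrite powR1.
      by apply: ge0_ler_powR => //; rewrite ?nnegrE // ltW.
  + rewrite invey adde0 => -[/(congr1 GRing.inv)]; rewrite invrK invr1 => r_1.
    rewrite mul1e NV r_1 invr1 poweRe1; last first.
      by apply: integral_ge0 => t _; rewrite lee_fin powR_ge0.
    apply: ge0_le_integral => //.
      by under eq_fun do rewrite powRr1 //.
    by move=> t _; rewrite lee_fin powRr1 // ler_piMl.
  + by rewrite inveNy addeNy.
- move=> _; rewrite invey add0e => /eqP; rewrite inve_eq1 => /eqP -> N N0 Noo NE.
  have -> : kernel_norm 1%:E h = \int[mu]_(t in D) `|h t|.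
    rewrite /kernel_norm invr1 powRr1.
      by apply: eq_Rintegral => t _; rewrite powRr1.
    by apply: Rintegral_ge0 => t _; exact: powR_ge0.
  have muT : (0 < mu [set: T])%E.
    by apply: lt_le_trans muD_gt0 _; apply: le_measure; rewrite ?inE.
  have V_le : \forall t \ae mu, D t -> (`|h t| * V t <= `|h t| * fine N).
    have := ess_sup_ge mu (abse \o ((EFin \o V) \_ D)).
    apply: filterS => t /=; rewrite /patch => Vt Dt; rewrite ler_wpM2l //.
    rewrite -lee_fin NE /N unlock muT; apply: le_trans Vt.
    by rewrite mem_set //= lee_fin ger0_norm.
  apply: (@le_trans _ _ (\int[mu]_(t in D) (`|h t| * fine N)%:E)%E).
    apply: ae_ge0_le_integral => //.
    - by move=> t _; rewrite lee_fin mulr_ge0 // fine_ge0.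
    - by apply/measurable_EFinP; exact: measurable_funM.
  under eq_integral do rewrite EFinM.
  rewrite ge0_integralZr //; last by rewrite NE.
  by rewrite (@fin_num_integral_bounded (fun t => `|h t|) 1) // NE.
Qed.

End hoelder_bounded.

(** * Integrating a real kernel against a complex function *)

Section kernel_integral.
Context d (T : measurableType d) (R : realType) (mu : {measure set T -> \bar R}).
Variables (D : set T) (F : T -> R[i]).
Hypothesis mD : measurable D.
Hypotheses (mRe : measurable_fun D (fun t => complex.Re (F t)))
           (mIm : measurable_fun D (fun t => complex.Im (F t))).
Implicit Types (h : T -> R).

Definition kernel_integral h : R[i] :=
  ((\int[mu]_(t in D) (h t * complex.Re (F t))) +i*
   (\int[mu]_(t in D) (h t * complex.Im (F t))))%C.

Definition bounded_kernel h :=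
  measurable_fun D h /\ exists b, forall t, `|h t| <= b.

Lemma measurable_cabs : measurable_fun D (fun t => cabs (F t)).
Proof.
have -> : (fun t => cabs (F t)) =
    (fun t => Num.sqrt (complex.Re (F t) ^+ 2 + complex.Im (F t) ^+ 2)).
  by apply/funext => t; rewrite /cabs; case: (F t).
apply: (measurableT_comp (f := @Num.sqrt R)).
  by apply: continuous_measurable_fun; exact: sqrt_continuous.
by apply: measurable_funD; exact: measurable_funX.
Qed.

Hypothesis iF : mu.-integrable D (fun t => (cabs (F t))%:E).

Lemma integrable_kernel (g : T -> R) h : measurable_fun D g ->
  (forall t, `|g t| <= cabs (F t)) -> bounded_kernel h ->
  mu.-integrable D (fun t => (h t * g t)%:E).
Proof.
move=> mg gF [mh [b hb]].
apply: (@le_integrable _ _ _ mu D mD _ (fun t => (b * cabs (F t))%:E)).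
- by apply/measurable_EFinP; exact: measurable_funM.
- move=> t _; rewrite /= lee_fin normrM normrM (ger0_norm (cabs_ge0 _)).
  by apply: ler_pM => //; apply: le_trans (hb t) (ler_norm _).
- by under eq_fun do rewrite EFinM; exact: integrableZl.
Qed.

Let iRe h : bounded_kernel h -> mu.-integrable D (fun t => (h t * complex.Re (F t))%:E).
Proof. by apply: integrable_kernel => // t; exact: Re_le_cabs. Qed.

Let iIm h : bounded_kernel h -> mu.-integrable D (fun t => (h t * complex.Im (F t))%:E).
Proof. by apply: integrable_kernel => // t; exact: Im_le_cabs. Qed.

Let iZ c (g : T -> R) : mu.-integrable D (fun t => (g t)%:E) ->
  mu.-integrable D (fun t => (c * g t)%:E).
Proof. by move=> ig; under eq_fun do rewrite EFinM; exact: integrableZl. Qed.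

Lemma bounded_kernelD h1 h2 : bounded_kernel h1 -> bounded_kernel h2 ->
  bounded_kernel (fun t => h1 t + h2 t).
Proof.
move=> [m1 [b1 hb1]] [m2 [b2 hb2]]; split; first exact: measurable_funD.
by exists (b1 + b2) => t; apply: le_trans (ler_normD _ _) (lerD _ _).
Qed.

Lemma kernel_integralD h1 h2 : bounded_kernel h1 -> bounded_kernel h2 ->
  kernel_integral (fun t => h1 t + h2 t) = kernel_integral h1 + kernel_integral h2.
Proof.
move=> b1 b2; rewrite /kernel_integral; congr (_ +i* _)%C.
- under eq_Rintegral do rewrite mulrDl.
  by rewrite RintegralD //; exact: iRe.
- under eq_Rintegral do rewrite mulrDl.
  by rewrite RintegralD //; exact: iIm.
Qed.

Lemma kernel_integralZ c h : bounded_kernel h ->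
  kernel_integral (fun t => c * h t) = (c%:C)%C * kernel_integral h.
Proof.
move=> bh; rewrite /kernel_integral realM_complex.
congr (_ +i* _)%C; under eq_Rintegral do rewrite -mulrA.
- by rewrite RintegralZl //; exact: iRe.
- by rewrite RintegralZl //; exact: iIm.
Qed.

(** With [v] the integral, [|v|^2] is the integral of [h] against the real
    function [Re (v^* F)], which is at most [|v| |F|]. *)
Lemma cabs_kernel_integral h : bounded_kernel h ->
  cabs (kernel_integral h) <= \int[mu]_(t in D) (`|h t| * cabs (F t)).
Proof.
move=> bh; set v := kernel_integral h; set I := Rintegral _ _ _.
have bhn : bounded_kernel (fun t => `|h t|).
  case: bh => mh [b hb]; split; first exact: measurableT_comp.
  by exists b => t; rewrite normr_id.
have ihF : mu.-integrable D (fun t => (`|h t| * cabs (F t))%:E).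
  apply: integrable_kernel => //; first exact: measurable_cabs.
  by move=> t; rewrite ger0_norm ?cabs_ge0.
have I0 : 0 <= I by apply: Rintegral_ge0 => t _; rewrite mulr_ge0 ?cabs_ge0.
have : cabs v ^+ 2 <= cabs v * I.
  rewrite sqr_cabs !expr2 {2}/v {3}/v /=.
  rewrite -RintegralZl //; last exact: iRe.
  rewrite -RintegralZl //; last exact: iIm.
  rewrite -RintegralZl // -RintegralD //; last 2 first.
  - by apply: iZ; exact: iRe.
  - by apply: iZ; exact: iIm.
  apply: le_Rintegral => //.
  - exact: (integrableD mD (iZ (complex.Re v) (iRe bh)) (iZ (complex.Im v) (iIm bh))).
  - exact: iZ.
  move=> t _.
  have -> : complex.Re v * (h t * complex.Re (F t)) + complex.Im v * (h t * complex.Im (F t)) =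
     h t * complex.Re ((v^*)%C * F t).
    by case: (v) => a b; case: (F t) => x y /=; ring.
  rewrite mulrCA; apply: le_trans (ler_norm _) _; rewrite normrM ler_wpM2l //.
  by apply: le_trans (Re_le_cabs _) _; rewrite cabsM cabs_conj.
have [->|v0] := eqVneq (cabs v) 0; first by move=> _; exact: I0.
by rewrite expr2 ler_pM2l // lt_neqAle eq_sym v0 cabs_ge0.
Qed.

End kernel_integral.

(** * The Poisson kernel as a cosine series *)

Section fourier_kernels.
Context {R : realType}.
Local Notation mu := (@completed_lebesgue_measure R).
Local Notation circle := (`[0, 2 * pi]%classic : set (lebesgueTypeR R)).
Implicit Types (z w u : R[i]) (t : R) (k N : nat).

Lemma cisD (s t : R) : cis (s + t) = cis s * cis t.
Proof.
apply/eqP; rewrite eq_complex /= cosD sinD eqxx /=.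
by apply/eqP; ring.
Qed.

Lemma cis0 : cis (0 : R) = 1.
Proof. by rewrite /cis cos0 sin0. Qed.

Lemma cabs_cis t : cabs (cis t) = 1.
Proof. by rewrite /cabs /= cos2Dsin2 sqrtr1. Qed.

Lemma cis_natM t k : cis (k%:R * t) = cis t ^+ k.
Proof.
elim: k => [|k IH]; first by rewrite mul0r cis0.
by rewrite -natr1 mulrDl mul1r addrC cisD IH exprS.
Qed.

Lemma polar u : exists phi, u = ((cabs u)%:C)%C * cis phi.
Proof.
have [u0|u0] := eqVneq (cabs u) 0.
  by exists 0; rewrite (cabs_eq0 u0) cabs0 mul0r.
have cu0 : 0 < cabs u by rewrite lt_neqAle eq_sym u0 cabs_ge0.
case: u u0 cu0 => a b; set r := cabs _ => u0 r0.
have rE : r ^+ 2 = a ^+ 2 + b ^+ 2 by rewrite /r sqr_cabs.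
have ar : -1 <= a / r <= 1.
  by rewrite -ler_norml normrM normfV (gtr0_norm r0) ler_pdivrMr // mul1r; exact: (Re_le_cabs (a +i* b)%C).
have ca : cos (acos (a / r)) = a / r by rewrite acosK // in_itv.
have sa : sin (acos (a / r)) = `|b| / r.
  rewrite sin_acos //; have -> : 1 - (a / r) ^+ 2 = (`|b| / r) ^+ 2.
    rewrite !expr_div_n real_normK ?num_real //; apply/eqP.
    by rewrite subr_eq -mulrDl addrC -rE divff // expf_neq0.
  by rewrite sqrtr_sqr ger0_norm // divr_ge0 // ltW.
have [b0|b0] := leP 0 b.
  exists (acos (a / r)); rewrite /cis realM_complex ca sa ger0_norm //.
  by rewrite ![r * _]mulrC !divfK.
exists (- acos (a / r)); rewrite /cis realM_complex cosN sinN ca sa ltr0_norm //.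
by rewrite mulNr opprK ![r * _]mulrC !divfK.
Qed.

Definition harmonic_kernel k u t : R := complex.Re (u * cis (- (k%:R * t))).

(** The sum [Re w^(N+1) + Re w^(N+2) + ...] for [w = z e^(-it)], in closed form. *)
Definition poisson_tail N z t : R :=
  complex.Re ((z * cis (- t)) ^+ N.+1 / (1 - z * cis (- t))).

Lemma harmonic_kernelB k u w t :
  harmonic_kernel k (u - w) t = harmonic_kernel k u t - harmonic_kernel k w t.
Proof. by rewrite /harmonic_kernel mulrBl ReB. Qed.

(** If [u = |u| e^(i phi)], then the kernel is [|u| cos (kt - phi)]. *)
Lemma harmonic_kernel_polar k u : exists c, forall t,
  harmonic_kernel k u t = cabs u * cos (k%:R * t + c).
Proof.
have [phi uE] := polar u; exists (- phi) => t.
rewrite /harmonic_kernel {1}uE -mulrA -cisD realM_complex /=.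
by rewrite -cosN opprD opprK addrC.
Qed.

Lemma poisson_kernel_series w : cabs w < 1 ->
  2^-1 * poisson_kernel w = 2^-1 + complex.Re (w / (1 - w)).
Proof.
move=> w1; have d0 : cabs (1 - w) ^+ 2 != 0.
  rewrite expf_neq0 // gt_eqF // ; apply: lt_le_trans (cabsB _ _).
  by rewrite cabs1 subr_gt0.
rewrite /poisson_kernel; move: d0; rewrite !sqr_cabs.
case: w w1 => x y _ /=.
rewrite !sub0r !sqrrN => d0.
rewrite -/(_ ^+ 2); field.
by [].
Qed.

Lemma one_sub_neq0 w : cabs w < 1 -> 1 - w != 0.
Proof.
move=> w1; apply/eqP => w0.
by have := cabsB 1 w; rewrite w0 cabs0 cabs1 subr_le0 leNgt w1.
Qed.

Lemma cabs_mul_cis z t : cabs (z * cis t) = cabs z.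
Proof. by rewrite cabsM cabs_cis mulr1. Qed.

Lemma poisson_tailS N z t : cabs z < 1 ->
  poisson_tail N z t = harmonic_kernel N.+1 (z ^+ N.+1) t + poisson_tail N.+1 z t.
Proof.
move=> z1; rewrite /poisson_tail /harmonic_kernel -[- (N.+1%:R * t)]mulrN cis_natM -exprMn.
set w := z * _; have w1 : 1 - w != 0 by apply: one_sub_neq0; rewrite cabs_mul_cis.
rewrite -raddfD /=; congr complex.Re.
by rewrite [w ^+ N.+2]exprSr; field.
Qed.

Lemma poisson_tail_le N z t : cabs z < 1 ->
  `|poisson_tail N z t| <= cabs z ^+ N.+1 / (1 - cabs z).
Proof.
move=> z1; apply: le_trans (Re_le_cabs _) _.
have d0 : 0 < 1 - cabs z by rewrite subr_gt0.
rewrite cabsM cabsX cabs_mul_cis ler_wpM2l ?exprn_ge0 ?cabs_ge0 //.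
rewrite cabsV.
have h : 1 - cabs z <= cabs (1 - z * cis (- t)).
  by apply: le_trans (cabsB _ _); rewrite cabs_mul_cis cabs1.
by rewrite lef_pV2 ?posrE // (lt_le_trans d0 h).
Qed.

Lemma measurable_circle : measurable circle.
Proof. by apply: measurable_borel_lebesgue; exact: measurable_itv. Qed.

Lemma mu_circle : mu circle = (2 * pi)%:E.
Proof.
have := @lebesgue_measure_itv R `[0, 2 * pi].
by rewrite /= lte_fin mulr_gt0 ?pi_gt0 // sube0.
Qed.

Lemma continuous_harmonic_kernel k u : continuous (harmonic_kernel k u).
Proof.
have [c hc] := harmonic_kernel_polar k u.
have -> : harmonic_kernel k u = (fun t => cabs u * cos (k%:R * t + c)) by apply/funext.
by move=> t; apply: cvgM; [exact: cvg_cst|exact: continuous_cos_affine].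
Qed.

Lemma bounded_harmonic_kernel k u : bounded_kernel circle (harmonic_kernel k u).
Proof.
split; last by exists (cabs u) => t; apply: le_trans (Re_le_cabs _) _; rewrite cabs_mul_cis.
apply: continuous_measurable_lebesgue measurable_circle _.
exact: continuous_harmonic_kernel.
Qed.

Lemma continuous_poisson_kernel z : cabs z < 1 ->
  continuous (fun t => poisson_kernel (z * cis (- t))).
Proof.
move=> z1 t.
have imE s : complex.Im (z * cis (- s)) = harmonic_kernel 1 (- ('i%C * z)) s.
  by rewrite /harmonic_kernel mul1r; case: z z1 => a b _ /=; ring.
have reE s : complex.Re (z * cis (- s)) = harmonic_kernel 1 z s.
  by rewrite /harmonic_kernel mul1r.
have cE : (fun t => poisson_kernel (z * cis (- t))) =
    (fun t => (1 - cabs z ^+ 2) / ((1 - harmonic_kernel 1 z t) ^+ 2 +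
         harmonic_kernel 1 (- ('i%C * z)) t ^+ 2)).
  apply/funext => s; rewrite /poisson_kernel cabs_mul_cis; congr (_ / _).
  by rewrite sqr_cabs ReB ImB imE reE /= sub0r sqrrN.
rewrite cE; apply: cvgM; first exact: cvg_cst.
apply: cvgV.
  rewrite -reE -imE; have := one_sub_neq0 (w := z * cis (- t)).
  rewrite cabs_mul_cis => /(_ z1); apply: contra => /eqP h.
  apply/eqP/cabs_eq0/eqP; rewrite -sqrf_eq0 sqr_cabs ReB ImB /= sub0r sqrrN.
  by rewrite h.
apply: cvgD; apply: cvgM.
- by apply: cvgB; [exact: cvg_cst|exact: continuous_harmonic_kernel].
- by apply: cvgB; [exact: cvg_cst|exact: continuous_harmonic_kernel].
- exact: continuous_harmonic_kernel.
- exact: continuous_harmonic_kernel.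
Qed.

(** Measurability comes from the Poisson kernel for [N = 0], and passes from [N]
    to [N + 1] by removing one cosine. *)
Lemma bounded_poisson_tail N z : cabs z < 1 -> bounded_kernel circle (poisson_tail N z).
Proof.
move=> z1; split; last first.
  by exists (cabs z ^+ N.+1 / (1 - cabs z)) => t; exact: poisson_tail_le.
elim: N => [|N IH].
  have -> : poisson_tail 0 z = (fun t => 2^-1 * poisson_kernel (z * cis (- t)) - 2^-1).
    apply/funext => t; rewrite poisson_kernel_series ?cabs_mul_cis //.
    by rewrite addrC addKr /poisson_tail expr1.
  apply: continuous_measurable_lebesgue measurable_circle _ => t.
  apply: cvgB; last exact: cvg_cst.
  by apply: cvgM; [exact: cvg_cst|exact: continuous_poisson_kernel].
have -> : poisson_tail N.+1 z =
    (fun t => poisson_tail N z t - harmonic_kernel N.+1 (z ^+ N.+1) t).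
  by apply/funext => t; rewrite (poisson_tailS N t z1) addrAC subrr add0r.
apply: measurable_funB => //.
by have [] := bounded_harmonic_kernel N.+1 (z ^+ N.+1).
Qed.

End fourier_kernels.

(** * Geometric sums and limits of inequalities *)

Section elementary.
Context {R : realType}.
Implicit Types (r x y : R).

Lemma geometric_sum_le r m : 0 <= r < 1 -> \sum_(k < m) r ^+ k <= (1 - r)^-1.
Proof.
move=> /andP[r0 r1]; have d0 : 0 < 1 - r by rewrite subr_gt0.
rewrite -[leRHS]div1r ler_pdivlMr // mulrC -opprB mulNr -subrX1 opprB.
by rewrite lerBlDr lerDl exprn_ge0.
Qed.

Lemma arith_geometric_sum_le r m : 0 <= r < 1 ->
  \sum_(k < m) k.+1%:R * r ^+ k <= (1 - r) ^- 2.
Proof.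
move=> /andP[r0 r1]; have d0 : 0 < 1 - r by rewrite subr_gt0.
(* Multiplying by [(1 - r)^2] makes the sum telescope to a closed form. *)
have E : (\sum_(k < m) k.+1%:R * r ^+ k) * (1 - r) ^+ 2 =
    1 - (m.+1%:R * r ^+ m - m%:R * r ^+ m.+1).
  elim: m => [|m IH]; first by rewrite big_ord0 !mul0r mul1r expr0 subr0 subrr.
  rewrite big_ord_recr /= mulrDl IH -!natr1 !exprS; ring.
rewrite -[leRHS]div1r ler_pdivlMr ?exprn_gt0 // E lerBlDr lerDl subr_ge0.
by apply: ler_pM; rewrite ?ler0n ?exprn_ge0 ?ler_nat // exprS ler_piMl ?exprn_ge0 // ltW.
Qed.

(** Removes the remainder of a truncated expansion from an inequality. *)
Lemma le_of_geometric_error x y b r : 0 <= r < 1 ->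
  (forall N, x <= y + b * r ^+ N) -> x <= y.
Proof.
move=> /andP[r0 r1] h; apply/ler_addgt0Pr => e e0.
have rn : `|r| < 1 by rewrite ger0_norm.
have /cvgrPdist_lt /(_ _ e0) [N _ hN] : (fun N => b * r ^+ N) @ \oo --> b * 0.
  by apply: cvgMr; exact: cvg_expr.
apply: le_trans (h N) _; rewrite lerD2l.
have := hN N (leqnn _); rewrite mulr0 sub0r normrN => hb.
by apply: ltW; apply: le_lt_trans hb; exact: ler_norm.
Qed.

Lemma derive1_quadratic_error (phi : R -> R) l c : phi 0 = 0 ->
  (forall x, `|x| <= 2^-1 -> `|phi x - x * l| <= c * `|x| ^+ 2) ->
  derive1 phi 0 = l.
Proof.
move=> phi0 hphi; rewrite derive1E /derive; apply/cvg_lim; first exact: Rhausdorff.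
apply/cvgrPdist_le => e e0.
have c0 : 0 <= c.
  have := hphi 2^-1; rewrite ger0_norm ?invr_ge0 // => /(_ (lexx _)) h.
  by have := le_trans (normr_ge0 _) h; rewrite pmulr_lge0 // exprn_gt0 // invr_gt0.
have ec : 0 < e / (c + 1) by rewrite divr_gt0 // ltr_wpDl.
have half : 0 < 2^-1 :> R by rewrite invr_gt0.
have := @nbhsx_ballx _ R 0 _ ec; have := @nbhsx_ballx _ R 0 _ half.
rewrite -!ball_normE => near_half near_e.
have nz : \forall h \near (0 : R)^', h != 0 by exact: nbhs_dnbhs_neq.
near=> h.
have h0 : h != 0 by near: h.
have h1 : `|h| < 2^-1.
  rewrite -normrN -sub0r; near: h; exact: nbhs_dnbhs near_half.
have h2 : `|h| < e / (c + 1).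
  rewrite -normrN -sub0r; near: h; exact: nbhs_dnbhs near_e.
rewrite /= /GRing.scale /= mulr1 addr0 phi0 subr0.
have -> : l - h^-1 * phi h = - (h^-1 * (phi h - h * l)).
  by rewrite mulrBr mulrA mulVf // mul1r opprB.
rewrite normrN normrM normfV ler_pdivrMl ?normr_gt0 //.
apply: le_trans (hphi h (ltW h1)) _; rewrite expr2 mulrA [leRHS]mulrC.
rewrite ler_wpM2r //; apply: le_trans (_ : (c + 1) * `|h| <= _).
  by rewrite ler_wpM2r // lerDl.
by rewrite mulrC -ler_pdivlMr ?ltW // ltr_wpDl.
Unshelve. all: by end_near.
Qed.

End elementary.

(** * Expansion of the Poisson integral *)

Section expansion_of_poisson_integral.
Context {R : realType}.
Local Notation mu := (@completed_lebesgue_measure R).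
Local Notation circle := (`[0, 2 * pi]%classic : set (lebesgueTypeR R)).
Variables (p q : \bar R) (F : R[i] -> R[i]).
Hypotheses (hp : (1 <= p)%E) (hpq : (p^-1 + q^-1 = 1)%E) (hF : circle_Lp p F).
Implicit Types (z w u : R[i]) (k N n : nat).

Let G (t : lebesgueTypeR R) : R[i] := F (cis t).
Let normF : R := fine (circle_Lnorm p F).

Let mRe : measurable_fun circle (fun t => complex.Re (G t)).
Proof. by case: hF => -[]. Qed.

Let mIm : measurable_fun circle (fun t => complex.Im (G t)).
Proof. by case: hF => -[]. Qed.

Let mG : measurable_fun circle (fun t => cabs (G t)).
Proof. exact: measurable_cabs. Qed.

Let pi2_gt0 : 0 < 2 * pi :> R.
Proof. by rewrite mulr_gt0 ?pi_gt0. Qed.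

Let mu_gt0 : (0 < mu circle)%E.
Proof. by rewrite mu_circle lte_fin. Qed.

Let mu_fin : (mu circle < +oo)%E.
Proof. by rewrite mu_circle ltry. Qed.

Lemma circle_norm_ge0 : 0 <= normF.
Proof. by apply: fine_ge0; exact: Lnorm_ge0. Qed.

Let hoelder_circle (h : lebesgueTypeR R -> R) : measurable_fun circle h ->
  (forall t, `|h t| <= 1) ->
  (\int[mu]_(t in circle) (`|h t| * cabs (G t))%:E <=
   (kernel_norm mu circle q h * normF)%:E)%E.
Proof.
move=> mh h1; have [_ Foo] := hF.
apply: (hoelder_bounded (@measurable_circle R) mu_gt0 mu_fin mh mG h1 _ hp hpq Foo).
by move=> t; exact: cabs_ge0.
Qed.

Lemma integrable_circle : mu.-integrable circle (fun t => (cabs (G t))%:E).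
Proof.
apply/integrableP; split; first exact/measurable_EFinP.
have m1 : measurable_fun circle (fun=> 1 : R) by exact: measurable_cst.
have := hoelder_circle m1; rewrite normr1 => /(_ (fun=> lexx _)).
under eq_integral do rewrite mul1r.
under [X in _ -> (X < _)%E]eq_integral do rewrite /= ger0_norm ?cabs_ge0 //.
by move=> /le_lt_trans; apply; exact: ltry.
Qed.

Let Rintegral_cosE (s : R) k (c : R) : 1 <= s ->
  \int[mu]_(t in circle) (`|cos (k%:R * t + c)| `^ s) =
  \int[@lebesgue_measure R]_(t in `[0, 2 * pi]) (`|cos (k%:R * t + c)| `^ s).
Proof.
move=> s1; rewrite /Rintegral ge0_integral_completed //.
apply/measurable_EFinP; apply: (@measurable_funS _ _ _ _ setT) => //.
apply: continuous_measurable_fun; exact: continuous_cos_powR.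
Qed.

(** [C_q] is normalized by [dt / (2 pi)] while the kernel norm is not; the missing
    factor [(2 pi)^(1/q)] is at most [2 pi] because [q >= 1]. *)
Lemma kernel_norm_cos k n (c : R) : (0 < k)%N -> (0 < n)%N ->
  kernel_norm mu circle q (fun t => cos (k%:R * t + c)) <= 2 * pi * Cq q n.
Proof.
move=> k0 n0; have pi2_ge1 : 1 <= 2 * pi :> R by have := @pi_ge2 R; lra.
have q1 : (1 <= q)%E.
  have -> : q = hoelder_conjugate p.
    by apply/hoelder_conjugateP => //; [rewrite (lt_le_trans _ hp) // ltNyr|rewrite gt_eqF // (lt_le_trans _ hp) // lte01].
  exact: hoelder_conj_ge1.
move: q1; rewrite /kernel_norm /Cq; case: q => [s|_|//]; last by rewrite mulr1.
rewrite lee_fin => s1; have s0 : 0 < s by exact: lt_le_trans s1.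
rewrite Rintegral_cosE //.
under [X in _ <= _ * (_ * X) `^ _]eq_Rintegral do rewrite -[_ * _]addr0.
rewrite Rintegral_cosE // !(integral_cos_powR _ s1 _ n0) //.
set I := Rintegral _ _ _.
have I0 : 0 <= I by apply: Rintegral_ge0 => t _; exact: powR_ge0.
rewrite powRM ?invr_ge0 ?(ltW pi2_gt0) // mulrA ler_peMl ?powR_ge0 //.
rewrite -ler_pdivrMl // mulr1; apply: ger1_powR; last by rewrite invf_le1.
by rewrite invr_gt0 pi2_gt0 invf_le1.
Qed.

Definition circle_integral (h : R -> R) : R[i] := kernel_integral mu circle G h.

Let eqI (h1 h2 : R -> R) : h1 =1 h2 -> circle_integral h1 = circle_integral h2.
Proof. by move=> /funext ->. Qed.

Let mC := @measurable_circle R.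

Let ID (h1 h2 : R -> R) : bounded_kernel circle h1 -> bounded_kernel circle h2 ->
  circle_integral (fun t => h1 t + h2 t) = circle_integral h1 + circle_integral h2.
Proof. exact: (kernel_integralD mC mRe mIm integrable_circle). Qed.

Let IZ (c : R) (h : R -> R) : bounded_kernel circle h ->
  circle_integral (fun t => c * h t) = (c%:C)%C * circle_integral h.
Proof. exact: (kernel_integralZ mC mRe mIm integrable_circle). Qed.

Let cabs_I (h : R -> R) : bounded_kernel circle h ->
  cabs (circle_integral h) <= \int[mu]_(t in circle) (`|h t| * cabs (G t)).
Proof. exact: (cabs_kernel_integral mC mRe mIm integrable_circle). Qed.

(** In terms of the usual coefficients [a_k] and [b_k] of [f], this is
    [a_k u + conj (b_k u)]; bounding it for all [u] bounds [|a_k| + |b_k|]. *)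
Definition fourier_coef k u : R[i] :=
  ((pi^-1)%:C)%C * circle_integral (harmonic_kernel k u).

Definition poisson_remainder N z : R[i] :=
  ((pi^-1)%:C)%C * circle_integral (poisson_tail N z).

Let L1norm := pi^-1 * \int[mu]_(t in circle) cabs (G t).

Let bhk k u := @bounded_harmonic_kernel R k u.

Lemma fourier_coefB k u w : fourier_coef k (u - w) = fourier_coef k u - fourier_coef k w.
Proof.
rewrite /fourier_coef -mulrBr; congr (_ * _).
rewrite -(@eqI (fun t => harmonic_kernel k (u - w) t + harmonic_kernel k w t) (harmonic_kernel k u)).
  by rewrite ID // addrK.
by move=> t; rewrite harmonic_kernelB subrK.
Qed.

Lemma fourier_coefZ k (c : R) u :
  fourier_coef k ((c%:C)%C * u) = (c%:C)%C * fourier_coef k u.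
Proof.
rewrite /fourier_coef mulrCA -(IZ c) //; congr (_ * _).
apply: eqI => t; rewrite /harmonic_kernel -mulrA.
by case: (u * _) => x y; rewrite realM_complex.
Qed.

Let cabs_piV (v : R[i]) : cabs (((pi^-1)%:C)%C * v) = pi^-1 * cabs v.
Proof. by rewrite cabsM cabs_real ger0_norm // invr_ge0 pi_ge0. Qed.

Let normGG t : `|cabs (G t)| <= cabs (G t).
Proof. by rewrite ger0_norm ?cabs_ge0. Qed.

Lemma cabs_fourier_coef k n u : (0 < k)%N -> (0 < n)%N ->
  cabs (fourier_coef k u) <= 2 * Cq q n * normF * cabs u.
Proof.
move=> k0 n0; rewrite cabs_piV.
have := cabs_I (bhk k u).
have [c hc] := harmonic_kernel_polar k u.
pose h (t : lebesgueTypeR R) : R := cos (k%:R * t + c).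
have mh : measurable_fun circle h.
  by apply: continuous_measurable_lebesgue => //; exact: continuous_cos_affine.
have h1 t : `|h t| <= 1 by rewrite ler_norml cos_geN1 cos_le1.
have bh : bounded_kernel circle (fun t => `|h t|).
  by split; [exact: measurableT_comp|exists 1 => t; rewrite normr_id].
have ih : mu.-integrable circle (fun t => (`|h t| * cabs (G t))%:E).
  exact: (integrable_kernel mC integrable_circle mG normGG bh).
under eq_Rintegral do rewrite hc normrM (ger0_norm (cabs_ge0 _)) -mulrA.
rewrite RintegralZl // => le1.
have le2 : \int[mu]_(t in circle) (`|h t| * cabs (G t)) <= 2 * pi * Cq q n * normF.
  rewrite -lee_fin /Rintegral fineK ?integrable_fin_num //.
  apply: le_trans (hoelder_circle mh h1) _.
  by rewrite lee_fin ler_wpM2r ?circle_norm_ge0 // kernel_norm_cos.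
rewrite ler_pdivrMl ?pi_gt0 //; apply: le_trans le1 _.
apply: le_trans (ler_wpM2l (cabs_ge0 _) le2) _.
by rewrite le_eqVlt; apply/orP; left; apply/eqP; ring.
Qed.

Lemma cabs_poisson_remainder N z : cabs z < 1 ->
  cabs (poisson_remainder N z) <= L1norm * (cabs z ^+ N.+1 / (1 - cabs z)).
Proof.
move=> z1; rewrite cabs_piV /L1norm -mulrA ler_wpM2l ?invr_ge0 ?pi_ge0 //.
set b := _ / _.
have bt := bounded_poisson_tail N z1.
have bt' : bounded_kernel circle (fun t => `|poisson_tail N z t|).
  have [m1 [b' hb']] := bt.
  by split; [exact: measurableT_comp|exists b' => t; rewrite normr_id].
apply: le_trans (cabs_I bt) _.
rewrite [leRHS]mulrC -RintegralZl //; last exact: integrable_circle.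
apply: le_Rintegral => //.
- exact: (integrable_kernel mC integrable_circle mG normGG bt').
- have := integrableZl mC b integrable_circle.
  by apply: eq_integrable.
- by move=> t _; rewrite ler_wpM2r ?cabs_ge0 // poisson_tail_le.
Qed.

Lemma poisson_remainderS N z : cabs z < 1 ->
  poisson_remainder N z = fourier_coef N.+1 (z ^+ N.+1) + poisson_remainder N.+1 z.
Proof.
move=> z1; rewrite /poisson_remainder /fourier_coef -mulrDr; congr (_ * _).
rewrite -ID //; last exact: bounded_poisson_tail.
by apply: eqI => t; exact: poisson_tailS.
Qed.

Lemma poisson_expansion N z : cabs z < 1 ->
  poisson_integral F z = poisson_integral F 0 +
    \sum_(k < N) fourier_coef k.+1 (z ^+ k.+1) + poisson_remainder N z.
Proof.
pose c0 := ((pi^-1)%:C)%C * circle_integral (fun=> 2^-1).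
have bhalf : bounded_kernel circle (fun=> 2^-1 : R).
  by split; [exact: measurable_cst|exists `|2^-1|].
have expand0 w : cabs w < 1 -> poisson_integral F w = c0 + poisson_remainder 0 w.
  move=> w1; have btl := bounded_poisson_tail 0 w1.
  have bsum := bounded_kernelD bhalf btl.
  rewrite /c0 /poisson_remainder -mulrDr -ID //.
  have -> : poisson_integral F w = (((2 * pi)^-1)%:C)%C *
      circle_integral (fun t => poisson_kernel (w * cis (- t))).
    by rewrite /circle_integral /kernel_integral realM_complex.
  rewrite -(@eqI (fun t => 2 * (2^-1 + poisson_tail 0 w t))).
    rewrite IZ // mulrA -rmorphM /=; congr (_%:C%C * _).
    by rewrite invfM mulrAC mulVf // mul1r.
  move=> t; rewrite /poisson_tail expr1 -poisson_kernel_series ?cabs_mul_cis //.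
  by rewrite mulrA divff // mul1r.
have -> : poisson_integral F 0 = c0.
  have h0 : cabs (0 : R[i]) < 1 by rewrite cabs0.
  rewrite expand0 //; suff -> : poisson_remainder 0 0 = 0 by rewrite addr0.
  apply/cabs_eq0/eqP; rewrite eq_le cabs_ge0 andbT.
  by apply: le_trans (cabs_poisson_remainder 0 h0) _; rewrite cabs0 expr1 mul0r mulr0.
move=> z1; elim: N => [|N IH]; first by rewrite big_ord0 addr0 expand0.
by rewrite IH big_ord_recr /= (poisson_remainderS N z1) !addrA.
Qed.


Lemma poisson_remainder_le : exists2 b, 0 <= b & forall N z, cabs z < 1 ->
  cabs (poisson_remainder N z) <= b * (cabs z ^+ N.+1 / (1 - cabs z)).
Proof.
exists L1norm; last by move=> N z; exact: cabs_poisson_remainder.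
rewrite mulr_ge0 ?invr_ge0 ?pi_ge0 //.
by apply: Rintegral_ge0 => t _; exact: cabs_ge0.
Qed.

End expansion_of_poisson_integral.

(** * Normalized Poisson integrals *)

Section directional.
Context {R : realType}.
Variable g : R[i] -> R[i].

Let directional (u : R[i]) : R[i] :=
  (derive1 (fun x : R => complex.Re (g ((x%:C)%C * u))) 0 +i*
   derive1 (fun x : R => complex.Im (g ((x%:C)%C * u))) 0)%C.

Lemma partial_x_directional : partial_x g 0 = directional 1.
Proof.
have E (x : R) : ((x%:C)%C * 1)%R = (x +i* complex.Im (0 : R[i]))%C by rewrite mulr1.
rewrite /directional; under eq_fun do rewrite E.
by under [X in (_ +i* derive1 X _)%C]eq_fun do rewrite E.
Qed.

Lemma partial_y_directional : partial_y g 0 = directional 'i%C.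
Proof.
have E (x : R) : ((x%:C)%C * 'i%C)%R = (complex.Re (0 : R[i]) +i* x)%C.
  by rewrite realM_complex mulr0 mulr1.
rewrite /directional; under eq_fun do rewrite E.
by under [X in (_ +i* derive1 X _)%C]eq_fun do rewrite E.
Qed.

End directional.

Section normalized.
Context {R : realType}.
Variables (p q : \bar R) (F : R[i] -> R[i]) (n : nat).
Hypotheses (hp : (1 <= p)%E) (hpq : (p^-1 + q^-1 = 1)%E) (hn : (0 < n)%N)
  (hF : circle_Lp p F).
Local Notation f := (poisson_integral F).
Local Notation Lam := (2 * Cq q n * fine (circle_Lnorm p F)).
Hypotheses (f0 : f 0 = 0) (fz : dz f 0 - 1 = 0) (fzbar : dzbar f 0 = 0).
Implicit Types (z w u : R[i]).

Let expansion N z : cabs z < 1 -> f z =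
  \sum_(k < N) fourier_coef F k.+1 (z ^+ k.+1) + poisson_remainder F N z.
Proof. by move=> z1; rewrite (poisson_expansion hp hpq hF N z1) f0 add0r. Qed.

(** In the direction [u], the expansion with one term is [x L_1 u] up to an error
   of order [x^2], so [L_1 u] is the derivative. *)
Let derive1_direction u : cabs u = 1 ->
  derive1 (fun x : R => complex.Re (f ((x%:C)%C * u))) 0 =
    complex.Re (fourier_coef F 1 u) /\
  derive1 (fun x : R => complex.Im (f ((x%:C)%C * u))) 0 =
    complex.Im (fourier_coef F 1 u).
Proof.
move=> u1; have [b b0 hb] := poisson_remainder_le hp hpq hF.
have error (x : R) : `|x| <= 2^-1 ->
    cabs (f ((x%:C)%C * u) - (x%:C)%C * fourier_coef F 1 u) <= 2 * b * `|x| ^+ 2.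
  move=> x2.
  have xu : cabs ((x%:C)%C * u) = `|x| by rewrite cabsM cabs_real u1 mulr1.
  have xu1 : cabs ((x%:C)%C * u) < 1 by rewrite xu; lra.
  rewrite (expansion 1 xu1) big_ord1 expr1 (fourier_coefZ hp hpq hF) addrAC subrr add0r.
  apply: le_trans (hb 1%N _ xu1) _; rewrite xu.
  have -> : 2 * b * `|x| ^+ 2 = b * (`|x| ^+ 2 * 2) by ring.
  rewrite ler_wpM2l // ler_wpM2l ?exprn_ge0 //.
  by rewrite -[leRHS]invrK lef_pV2 ?posrE; lra.
have re_mul (x : R) v : complex.Re ((x%:C)%C * v) = x * complex.Re v.
  by case: v => c d; rewrite realM_complex.
have im_mul (x : R) v : complex.Im ((x%:C)%C * v) = x * complex.Im v.
  by case: v => c d; rewrite realM_complex.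
have f00 : f (((0 : R)%:C)%C * u) = 0 by rewrite mul0r f0.
split; apply: (@derive1_quadratic_error _ _ _ (2 * b)); rewrite ?f00 // => x x2.
- by rewrite -re_mul -ReB; apply: le_trans (Re_le_cabs _) (error x x2).
- by rewrite -im_mul -ImB; apply: le_trans (Im_le_cabs _) (error x x2).
Qed.

(** The normalization reads [L_1 1 - i L_1 i = 2] and [L_1 1 + i L_1 i = 0]. *)
Let fourier_coef1_1i : fourier_coef F 1 1 = 1 /\ fourier_coef F 1 'i%C = 'i%C.
Proof.
have ci : cabs ('i%C : R[i]) = 1.
  by rewrite /cabs /= expr0n expr1n add0r sqrtr1.
have reim (z : R[i]) : (complex.Re z +i* complex.Im z)%C = z by case: z.
have px : partial_x f 0 = fourier_coef F 1 1.
  have [hre him] := derive1_direction (cabs1 (R := R)).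
  by rewrite partial_x_directional hre him reim.
have py : partial_y f 0 = fourier_coef F 1 'i%C.
  have [hre him] := derive1_direction ci.
  by rewrite partial_y_directional hre him reim.
move: fz fzbar; rewrite /dz /dzbar px py; set a := fourier_coef _ _ _; set b := fourier_coef _ _ _.
move=> /eqP; rewrite subr_eq0 => /eqP h1 h2.
have ii : 'i%C * 'i%C = -1 :> R[i] by rewrite -expr2 sqr_i.
have ha : a = 1.
  have -> : a = 2^-1 * (a - 'i%C * b) + 2^-1 * (a + 'i%C * b) by field.
  by rewrite h1 h2 addr0.
split=> //; have ib : 'i%C * b = -1.
  have -> : 'i%C * b = 2^-1 * (a + 'i%C * b) - 2^-1 * (a - 'i%C * b) by field.
  by rewrite h1 h2 sub0r.
have -> : b = - ('i%C * ('i%C * b)) by rewrite mulrA ii mulN1r opprK.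
by rewrite ib mulrN1 opprK.
Qed.

Let fourier_coef1 u : fourier_coef F 1 u = u.
Proof.
have [h1 hi] := fourier_coef1_1i; case: u => a b.
have -> : (a +i* b)%C = (a%:C)%C * 1 - ((- b)%:C)%C * 'i%C.
  by rewrite mulr1 realM_complex mulr0 mulr1; apply/eqP; rewrite eq_complex /= subr0 add0r opprK !eqxx.
by rewrite (fourier_coefB hp hpq hF) !(fourier_coefZ hp hpq hF) h1 hi.
Qed.

Let coef_le k u : cabs (fourier_coef F k.+1 u) <= Lam * cabs u.
Proof. exact: (cabs_fourier_coef hp hpq hF). Qed.

Let Lam_ge1 : 1 <= Lam.
Proof. by have := coef_le 0 1; rewrite fourier_coef1 cabs1 mulr1. Qed.

Let Lam_ge0 : 0 <= Lam.
Proof. exact: le_trans Lam_ge1. Qed.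

Let expansion2 N z : cabs z < 1 -> f z - z =
  \sum_(k < N) fourier_coef F k.+2 (z ^+ k.+2) + poisson_remainder F N.+1 z.
Proof.
move=> z1; rewrite (expansion N.+1 z1) big_ord_recl /= expr1 fourier_coef1.
ring.
Qed.

(** The terms from the second one on are at most [Lam |z|^k]. *)
Lemma poisson_integral_sub_id z : cabs z < 1 ->
  cabs (f z - z) <= Lam * (cabs z ^+ 2 / (1 - cabs z)).
Proof.
move=> z1; have [b b0 hb] := poisson_remainder_le hp hpq hF.
have r01 : 0 <= cabs z < 1 by rewrite cabs_ge0.
apply: (@le_of_geometric_error _ _ _ (b * (cabs z ^+ 2 / (1 - cabs z))) (cabs z)) => // N.
rewrite (expansion2 N z1); apply: le_trans (cabsD _ _) _; apply: lerD; last first.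
  have -> : b * (cabs z ^+ 2 / (1 - cabs z)) * cabs z ^+ N =
      b * (cabs z ^+ N.+2 / (1 - cabs z)) by rewrite (exprD _ 2 N); ring.
  exact: hb.
apply: le_trans (cabs_sum _ _ _) _.
apply: (@le_trans _ _ (\sum_(k < N) Lam * cabs z ^+ 2 * cabs z ^+ k)).
  by apply: ler_sum => k _; rewrite -mulrA -exprD -cabsX; exact: coef_le.
rewrite -mulr_sumr [leRHS]mulrA; apply: ler_wpM2l.
  by apply: mulr_ge0 => //; exact: sqr_ge0.
exact: geometric_sum_le.
Qed.

(** [L_k (z^k) - L_k (w^k) = L_k (z^k - w^k)] is at most [Lam k r^(k-1) |z - w|],
    and the sum of [k r^(k-1)] over [k >= 1] is [(1 - r)^-2]. *)
Lemma poisson_integral_contr (r : R) z w : r < 1 -> cabs z <= r -> cabs w <= r ->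
  cabs ((f z - z) - (f w - w)) <= Lam * ((1 - r) ^- 2 - 1) * cabs (z - w).
Proof.
move=> r1 zr wr; have [b b0 hb] := poisson_remainder_le hp hpq hF.
have r0 : 0 <= r by exact: le_trans (cabs_ge0 z) zr.
have r01 : 0 <= r < 1 by rewrite r0.
have z1 := le_lt_trans zr r1; have w1 := le_lt_trans wr r1.
have rem_le N v : cabs v <= r ->
    cabs (poisson_remainder F N.+1 v) <= b * (r ^+ 2 / (1 - r)) * r ^+ N.
  move=> vr; have v1 := le_lt_trans vr r1.
  apply: le_trans (hb _ _ v1) _; rewrite -mulrA ler_wpM2l //.
  have -> : r ^+ 2 / (1 - r) * r ^+ N = r ^+ N.+2 / (1 - r).
    by rewrite (exprD _ 2 N); ring.
  apply: ler_pM; rewrite ?exprn_ge0 ?cabs_ge0 ?invr_ge0 ?subr_ge0 ?(ltW v1) //.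
    by rewrite lerXn2r ?nnegrE ?cabs_ge0.
  by rewrite lef_pV2 ?posrE ?subr_gt0 // lerD2l lerN2.
apply: (@le_of_geometric_error _ _ _ (2 * (b * (r ^+ 2 / (1 - r)))) r) => // N.
rewrite (expansion2 N z1) (expansion2 N w1) opprD addrACA -sumrB.
apply: le_trans (cabsD _ _) _; apply: lerD; last first.
  apply: le_trans (cabsD _ _) _; rewrite cabsN -mulrA mulr_natl mulr2n.
  by apply: lerD; apply: rem_le.
apply: le_trans (cabs_sum _ _ _) _.
apply: (@le_trans _ _ (\sum_(k < N) Lam * (k.+2%:R * r ^+ k.+1 * cabs (z - w)))).
  apply: ler_sum => k _; rewrite -(fourier_coefB hp hpq hF).
  by apply: le_trans (coef_le _ _) _; rewrite ler_wpM2l // cabs_subX.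
rewrite -mulr_sumr -mulr_suml -[leRHS]mulrA ler_wpM2l // ler_wpM2r ?cabs_ge0 //.
rewrite lerBrDr; have := arith_geometric_sum_le N.+1 r01.
by rewrite big_ord_recl /= expr0 mulr1 addrC.
Qed.

Lemma poisson_integral_schlicht :
  let r0 := 1 - Num.sqrt (Lam ^+ 2 + Lam) / (Lam + 1) in
  let R0 := r0 - Lam * r0 ^+ 2 / (1 - r0) in
  univalent_on (disk r0) f /\ schlicht_disk f (disk r0) (disk R0).
Proof.
have Lam_gt0 : 0 < Lam by exact: lt_le_trans ltr01 Lam_ge1.
set L := Lam in Lam_gt0 *; pose s := Num.sqrt (L ^+ 2 + L) / (L + 1).
have L1 : 0 < L + 1 by rewrite addr_gt0.
have s_gt0 : 0 < s by rewrite divr_gt0 // sqrtr_gt0 addr_gt0 ?exprn_gt0.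
have sE : s ^+ 2 * (L + 1) = L.
  rewrite expr_div_n sqr_sqrtr; last by rewrite addr_ge0 ?exprn_ge0 ?(ltW Lam_gt0).
  by field; rewrite gt_eqF.
move=> r0 R0.
have -> : R0 = 1 - s - L * (1 - s) ^+ 2 / s by rewrite /R0 /r0 -/s subKr.
exact: (bloch_radius Lam_gt0 s_gt0 sE poisson_integral_sub_id poisson_integral_contr).
Qed.

End normalized.

Theorem theorem3p1 (R : realType) (p q : \bar R) (n : nat) (F : R[i] -> R[i])
    (hp : (1 <= p)%E) (hpq : (p^-1 + q^-1 = 1)%E) (hn : (0 < n)%N)
    (hF : circle_Lp p F) :
  let f := poisson_integral F in
  let normF := fine (circle_Lnorm p F) in
  let C := Cq q n in
  let r0 := 1 - Num.sqrt (4 * C ^+ 2 * normF ^+ 2 + 2 * C * normF)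
                / (2 * C * normF + 1) in
  let R0 := r0 - 2 * C * normF * r0 ^+ 2 / (1 - r0) in
  f 0 = 0 -> dz f 0 - 1 = 0 -> dzbar f 0 = 0 ->
  univalent_on (disk r0) f /\ schlicht_disk f (disk r0) (disk R0).
Proof.
move=> f normF C r0 R0 f0 fz fzbar.
have := poisson_integral_schlicht hp hpq hn hF f0 fz fzbar.
suff -> : (2 * C * normF) ^+ 2 + 2 * C * normF =
    4 * C ^+ 2 * normF ^+ 2 + 2 * C * normF by [].
by ring.
Qed.
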